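(* Let $1\le t\le p$. Then, up to isomorphism of $\mathbb{F}[B]$-modules, $$\mathrm{Res}^G_B(P_{V_t})=\begin{cases}U_{0,p}&\text{if } t\in\{1,p\},\\ U_{t-1,p}\oplus U_{p-t,p}&\text{otherwise.}\end{cases}$$
   Context: Let $p$ be an odd prime, $\mathbb{F}$ an algebraically closed field of characteristic $p$, $G=SL_2(\mathbb{F}_p)$ and $B\le G$ the subgroup of upper triangular matrices. All modules are finite-dimensional right modules. Let $\zeta$ be a generator of $\mathbb{F}_p^\times$, $g=\begin{pmatrix}1&1\\0&1\end{pmatrix}$ and $\lambda=\begin{pmatrix}\zeta&0\\0&\zeta^{-1}\end{pmatrix}$, so $B=\langle g,\lambda\rangle$. For $a\in\mathbb{Z}$, $S_a$ is the one-dimensional $\mathbb{F}[B]$-module on which $g$ acts trivially and $\lambda$ acts as $\zeta^a$. For $1\le b\le p$, $U_{a,b}$ is the (unique up to isomorphism) uniserial $\mathbb{F}[B]$-module of dimension $b$ whose composition factors, from the socle upwards, are $S_a,S_{a+2},S_{a+4},\dots$. For $1\le t\le p$, $V_t\subset\mathbb{F}[x,y]$ is the space of homogeneous polynomials of degree $t-1$ with right action $x^iy^j\cdot\begin{pmatrix}\alpha&\beta\\\gamma&\delta\end{pmatrix}=(\alpha x+\beta y)^i(\gamma x+\delta y)^j$; these are the simple $\mathbb{F}[G]$-modules. $P_{V_t}$ is the projective cover of $V_t$. *)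

(* Defs.v *)
From HB Require Import structures.
From mathcomp Require Import all_boot all_order all_algebra.
From mathcomp Require Import all_fingroup all_solvable all_character.
From mathcomp Require Import mpoly.

Set Implicit Arguments.
Unset Strict Implicit.
Unset Printing Implicit Defensive.

Import GRing.Theory.
Local Open Scope ring_scope.

(* Finite-dimensional right F[G]-modules are matrix representations
   rG : mx_representation F G n acting on row vectors by v |-> v *m rG x. *)

Section Modules.

Variables (F : fieldType) (gT : finGroupType) (G : {group gT}).
Local Notation reprG := (mx_representation F G).

Definition mxhom m n (rM : reprG m) (rN : reprG n) (f : 'M[F]_(m, n)) :=
  forall x, x \in G -> rM x *m f = f *m rN x.

Definition mxprojective m (rP : reprG m) :=
  forall n k (rM : reprG n) (rN : reprG k) (f : 'M_(n, k)) (h : 'M_(m, k)),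
    mxhom rM rN f -> row_full f -> mxhom rP rN h ->
  exists2 l : 'M_(m, n), mxhom rP rM l & l *m f = h.

(* P is projective and surjects onto V with superfluous kernel. *)
Definition projective_cover m n (rP : reprG m) (rV : reprG n) :=
  mxprojective rP /\
  exists f : 'M_(m, n),
    [/\ mxhom rP rV f, row_full f &
        forall W : 'M_m,
          mxmodule rP W -> row_full (W + kermx f)%MS -> row_full W].

Definition mxuniserial n (rG : reprG n) :=
  forall U W : 'M_n, mxmodule rG U -> mxmodule rG W ->
    (U <= W)%MS || (W <= U)%MS.

Definition mxdsum m n (rM : reprG m) (rN : reprG n) :=
  dadd_grepr (Representation rM) (Representation rN).

End Modules.

Definition mx2 (R : Type) (a b c d : R) : 'M[R]_2 :=
  \matrix_(i, j) if i == 0 then if j == 0 then a else b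
                 else if j == 0 then c else d.

Lemma det_mx2 (R : comNzRingType) (a b c d : R) :
  \det (mx2 a b c d) = a * d - b * c.
Proof.
rewrite (expand_det_row _ 0) !big_ord_recl big_ord0 addr0 /cofactor !det_mx11.
by rewrite !mxE /= expr0 mul1r expr1 mulN1r mulrN.
Qed.

Section SL2.

Variable p : nat.
Implicit Type u : {'GL_2(p)}.

Definition SL2 := [set u : {'GL_2(p)} | \det (GLval u) == 1].

Lemma SL2_group_set : group_set SL2.
Proof.
apply/group_setP; split=> [|u v]; rewrite !inE; first by rewrite det1.
by move=> /eqP du /eqP dv; rewrite GL_ME det_mulmx du dv mulr1.
Qed.
Canonical SL2_group := Group SL2_group_set.

Definition borel := [set u in SL2 | GLval u 1 0 == 0].

Lemma borel_group_set : group_set borel.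
Proof.
apply/group_setP; split=> [|u v].
  by rewrite inE group1 GL_1E mxE.
rewrite !inE => /andP[/eqP du /eqP u0] /andP[/eqP dv /eqP v0].
rewrite GL_ME det_mulmx du dv mulr1 eqxx /= mxE big_ord_recl big_ord1.
have -> : lift ord0 ord0 = 1 :> 'I_2 by apply: val_inj.
by rewrite u0 mul0r add0r v0 mulr0.
Qed.
Canonical borel_group := Group borel_group_set.

Lemma borel_sub : borel \subset SL2.
Proof. by apply/subsetP=> u; rewrite inE => /andP[]. Qed.

Lemma unitr_mx2 (a b c d : 'F_p) :
  a * d - b * c = 1 -> (mx2 a b c d : 'M_(2.-1.+1)) \is a GRing.unit.
Proof. by move=> d1; rewrite unitmxE det_mx2 d1 unitr1. Qed.

Lemma unip_det : (1 : 'F_p) * 1 - 1 * 0 = 1.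
Proof. by rewrite mulr0 subr0 mulr1. Qed.

Definition unip : {'GL_2(p)} := FinRing.Unit (unitr_mx2 unip_det).

Lemma torus_det (z : {unit 'F_p}) : val z * (val z)^-1 - 0 * 0 = 1.
Proof. by rewrite mulr0 subr0 divrr //; case: z. Qed.

Definition torus (z : {unit 'F_p}) : {'GL_2(p)} :=
  FinRing.Unit (unitr_mx2 (torus_det z)).

Lemma unip_borel : unip \in borel.
Proof. by rewrite !inE /= det_mx2 unip_det mxE /= !eqxx. Qed.

Lemma torus_borel z : torus z \in borel.
Proof. by rewrite !inE /= det_mx2 torus_det mxE /= !eqxx. Qed.

End SL2.

Section SL2Modules.

Variables (F : fieldType) (p : nat) (charFp : p \in [pchar F]).

(* The embedding of the prime field, a : 'F_p being read as a natural < p. *)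
Definition Fp_emb (a : 'F_p) : F := (a : nat)%:R.

Lemma Fp_emb_nat k : Fp_emb k%:R = k%:R.
Proof.
have p_pr := pcharf_prime charFp.
rewrite /Fp_emb val_Fp_nat // [in RHS](divn_eq k p) natrD natrM.
by rewrite (pcharf0 charFp) mulr0 add0r.
Qed.

Lemma Fp_emb1 : Fp_emb 1 = 1.
Proof. exact: (Fp_emb_nat 1). Qed.

Lemma Fp_emb0 : Fp_emb 0 = 0.
Proof. by []. Qed.

Lemma Fp_embD : {morph Fp_emb : a b / a + b}.
Proof.
move=> a b; rewrite -[a]natr_Zp -[b]natr_Zp -natrD !Fp_emb_nat.
by rewrite natrD.
Qed.

Lemma Fp_embM : {morph Fp_emb : a b / a * b}.
Proof.
move=> a b; rewrite -[a]natr_Zp -[b]natr_Zp -natrM !Fp_emb_nat.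
by rewrite natrM.
Qed.

Section Vt.

Variable t : nat.

Local Notation x := ('X_(0 : 'I_2) : {mpoly F[2]}).
Local Notation y := ('X_(1 : 'I_2) : {mpoly F[2]}).

(* The exponent of x^i y^(t-1-i); these monomials for i < t form the basis of
   V_t with respect to which its action is written. *)
Definition Vmnm (i : 'I_t) : 'X_{1..2} :=
  (U_(0%R) *+ i + U_(1%R) *+ (t.-1 - i))%MM.

Definition Vact (u : {'GL_2(p)}) (i : 'I_t) : {mpoly F[2]} :=
  (Fp_emb (GLval u 0 0) *: x + Fp_emb (GLval u 0 1) *: y) ^+ i
  * (Fp_emb (GLval u 1 0) *: x + Fp_emb (GLval u 1 1) *: y) ^+ (t.-1 - i).

Definition Vmx (u : {'GL_2(p)}) : 'M[F]_t :=
  \matrix_(i, k) (Vact u i)@_(Vmnm k).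

Lemma VmnmE i : 'X_[F, Vmnm i] = x ^+ i * y ^+ (t.-1 - i).
Proof. by rewrite /Vmnm mpolyXD !mpolyXn. Qed.

Lemma Vmnm_inj : injective Vmnm.
Proof.
move=> i k /(congr1 (fun m : 'X_{1..2} => m 0%R)).
rewrite !mnmDE !mulmnE !mnm1E /= !mul0n !addn0 !mul1n.
exact: val_inj.
Qed.

Lemma Vact_homog u i : Vact u i \is t.-1.-homog.
Proof.
have lin (a b : F) : a *: x + b *: y \is 1.-homog.
  by rewrite rpredD // rpredZ // dhomogX /= mdeg1.
have it : (i <= t.-1)%N by case: i => i /=; case: t.
rewrite -(subnKC it) -[X in (X + _)%N]mul1n -[X in (_ + X)%N]mul1n.
by apply: dhomogM; apply: dhomogMn.
Qed.

Lemma homog_Vmnm (q : {mpoly F[2]}) : (0 < t)%N ->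
  q \is t.-1.-homog -> q = \sum_i q@_(Vmnm i) *: 'X_[Vmnm i].
Proof.
move=> t0 hq; apply/mpolyP=> m; rewrite raddf_sum /=.
under eq_bigr => i _ do rewrite mcoeffZ mcoeffX.
have [dm|ndm] := eqVneq (mdeg m) t.-1; last first.
  rewrite (dhomog_nemf_coeff hq ndm) big1 // => i _.
  case: eqP => [e|_]; last by rewrite mulr0.
  by rewrite e (dhomog_nemf_coeff hq ndm) mul0r.
have lt_m : (m 0%R < t)%N.
  by rewrite -(prednK t0) ltnS -dm mdegE big_ord_recl leq_addr.
have mE : Vmnm (Ordinal lt_m) = m.
  apply/mnmP=> k; rewrite mnmDE !mulmnE !mnm1E /= -dm mdegE.
  rewrite big_ord_recl big_ord1 /= addKn.
  case: k => [[|[|//]]] hk /=; rewrite !(mul0n, mul1n, addn0, add0n);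
    by congr (m _); apply: val_inj.
rewrite (bigD1 (Ordinal lt_m)) //= mE eqxx mulr1 big1 ?addr0 // => i ne.
case: eqP => [e|_]; last by rewrite mulr0.
by case/eqP: ne; apply: Vmnm_inj; rewrite e mE.
Qed.

Let sub (u : {'GL_2(p)}) : 2.-tuple {mpoly F[2]} :=
  [tuple Fp_emb (GLval u 0 0) *: x + Fp_emb (GLval u 0 1) *: y;
         Fp_emb (GLval u 1 0) *: x + Fp_emb (GLval u 1 1) *: y].

Lemma VactE u i : 'X_[Vmnm i] \mPo sub u = Vact u i.
Proof. by rewrite VmnmE rmorphM !rmorphXn /= !comp_mpolyXU. Qed.

Lemma VactM u v i : Vact (u * v)%g i = Vact u i \mPo sub v.
Proof.
have lin k : Fp_emb (GLval (u * v)%g k 0) *: x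
               + Fp_emb (GLval (u * v)%g k 1) *: y
    = (Fp_emb (GLval u k 0) *: x + Fp_emb (GLval u k 1) *: y) \mPo sub v.
  rewrite GL_ME !mxE raddfD /= !comp_mpolyZ !comp_mpolyXU /=.
  rewrite !big_ord_recl !big_ord0 !addr0 /=.
  have -> : lift 0 0 = 1 :> 'I_2 by apply: val_inj.
  rewrite !Fp_embD !Fp_embM !scalerDr !scalerDl !scalerA.
  by rewrite -!addrA; congr (_ + _); rewrite addrCA.
by rewrite /Vact !lin rmorphM !rmorphXn.
Qed.

Lemma Vmx_repr : mx_repr (SL2 p) Vmx.
Proof.
split=> [|u v _ _].
  apply/matrixP=> i k; rewrite !mxE /Vact GL_1E !mxE /= Fp_emb1 Fp_emb0.
  rewrite !scale0r !scale1r addr0 add0r -VmnmE mcoeffX.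
  by rewrite (inj_eq Vmnm_inj).
apply/matrixP=> i k; rewrite !mxE VactM.
have t0 : (0 < t)%N by case: i => i; case: t.
rewrite [in LHS](homog_Vmnm t0 (Vact_homog u i)).
rewrite (raddf_sum (comp_mpoly (sub v))) raddf_sum.
by apply: eq_bigr => j _; rewrite /= comp_mpolyZ VactE mcoeffZ !mxE.
Qed.

Definition Vrepr := MxRepresentation Vmx_repr.

End Vt.

Variable zeta : {unit 'F_p}.
Local Notation reprB := (mx_representation F (borel_group p)).

(* Stated for every dimension so that it applies to series_repr below, whose
   dimension is only propositionally 1. *)
Definition is_S (a : int) n (rS : reprB n) :=
  [/\ n = 1%N, rS (unip p) = 1%:M &
      rS (torus zeta) = (Fp_emb (val zeta) ^ a)%:M].

(* A composition series Us of rU is listed increasingly, so series_repr i compUs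
   is the (i+1)-st composition factor counted from the socle. *)
Definition is_U (a : int) b (rU : reprB b) :=
  mxuniserial rU /\
  exists Us (compUs : mx_composition_series rU Us),
    (last 0 Us :=: 1%:M)%MS /\
    forall i, (i < size Us)%N -> is_S (a + 2 * i%:Z) (series_repr i compUs).

End SL2Modules.

(* Main.v *)
Require Import Defs.
From HB Require Import structures.
From mathcomp Require Import all_boot all_order all_algebra.
From mathcomp Require Import all_fingroup all_solvable all_character.
From mathcomp Require Import finfield mpoly ring.
Set Implicit Arguments.
Unset Strict Implicit.
Unset Printing Implicit Defensive.
Import GRing.Theory.
Local Open Scope ring_scope.

(** The restriction of a projective module to the Borel subgroup B is
    projective (mxprojective_subg), and a projective F[B]-module is determined
    by its largest quotient on which the unipotent generator g acts trivially,
    or dually by the g-invariant functionals th and their torus weights: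
    such a functional lifts to a homomorphism to the uniserial module of
    dimension p with the same top, and by a count of dimensions the lifts of a
    basis of functionals form an isomorphism (lift_top_rsim). The theorem thus
    amounts to the computation of the g-invariant functionals on P, the cover
    of V_(m+1), where t = m + 1.

    By Frobenius reciprocity, functionals of weight k, for 0 < k < p, are
    homomorphisms from P to the module induced from B, realized as the space
    of functions on the nonzero vectors of the plane over the prime field that
    are homogeneous of degree k. This space contains the forms of degree k, that
    is V_(k+1), and integrating against powers of determinants maps it onto
    V_(p-k). These maps are used directly, without constructing the induced
    module. To th is attached its trace, a homomorphism from P to V_(p-k)
    (trace_form_hom); if it vanishes, then th comes from a homomorphism from P
    to V_(k+1) (trace_form_eq0, by interpolation on the prime field). As P is
    the cover of a simple module with scalar endomorphisms, the only
    homomorphisms from P to some V_s are the multiples of the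
    covering map f, for s = m + 1 (cover_hom_other, cover_hom_scalar).

    Hence there are at most two invariant functionals up to combinations
    (unip_fixed_spanned): th0, the composite of f with the coefficient of x^m,
    of weight m and without trace, provided m > 0; and th1, of weight p - 1 - m
    and with trace f, provided m < p - 1. The second one exists because the
    forms of degree 2(p - 1) - m map onto those of degree m and f lifts along
    this map (trace_form_lift). For m = 0 and m = p - 1 only one of them remains,
    and its weight p - 1 is the trivial one. *)

(** * Restriction of projective modules *)

Section Restriction.

Variables (F : fieldType) (gT : finGroupType) (G : {group gT}).

Section Coaugmented.

Variables (n : nat) (rP : mx_representation F G n).
Local Notation rR := (regular_repr F G).

(** The module F[G] (x) P with diagonal action: the vector Sum_y y (x) v_y is
    stored as the matrix whose row number y is v_y, and the rows are permuted
    by the inverse of x in order to obtain a right action. *)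
Definition tensor_regular_mx x : 'M[F]_(#|G| * n) :=
  lin1_mx (mxvec \o mulmxr (rP x) \o mulmx (rR x^-1%g) \o vec_mx).

Lemma tensor_regularE x v :
  v *m tensor_regular_mx x = mxvec (rR x^-1%g *m vec_mx v *m rP x).
Proof. by rewrite mul_rV_lin1. Qed.

Lemma tensor_regular_mx_repr : mx_repr G tensor_regular_mx.
Proof.
split=> [|x y Gx Gy]; apply/row_matrixP=> i; rewrite !rowE.
  by rewrite tensor_regularE invg1 !repr_mx1 mul1mx !mulmx1 vec_mxK.
rewrite mulmxA !tensor_regularE mxvecK invMg !repr_mxM ?groupV //.
by rewrite !mulmxA.
Qed.

Definition tensor_regular := MxRepresentation tensor_regular_mx_repr.

(** Projectivity splits the surjection of F[G] (x) P onto P that forgets the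
    first factor. The component e of the splitting at the identity of G
    determines all the others by equivariance: the component at x is the
    conjugate of e by x, and they add up to the identity of P. *)
Lemma mxprojective_trace :
  mxprojective rP ->
  exists e : 'M_n, \sum_(x in G) rP x *m e *m rP x^-1%g = 1%:M.
Proof.
move=> projP.
pose f : 'M[F]_(#|G| * n, n) := lin1_mx (mulmx (const_mx 1) \o vec_mx).
have fE v : v *m f = const_mx 1 *m vec_mx v by rewrite mul_rV_lin1.
have const_R x : x \in G ->
    (const_mx 1 : 'rV[F]_#|G|) *m rR x = const_mx 1.
    move=> Gx; apply/rowP=> k; rewrite !mxE.
    have GkxV: (enum_val k * x^-1)%g \in G by rewrite groupM ?groupV ?enum_valP.
    rewrite (bigD1 (gring_index G (enum_val k * x^-1))) //= !mxE.
    rewrite gring_indexK // mulgKV gring_valK !eqxx mulr1 big1 ?addr0 // => i ne_i.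
    rewrite !mxE eqxx /=; case: eqP => [eqk|]; last by rewrite mulr0.
    case/eqP: ne_i; rewrite eqk gring_indexK ?groupM ?enum_valP //.
    by rewrite mulgK gring_valK.
have homf : mxhom tensor_regular rP f.
  move=> x Gx; apply/row_matrixP=> i; rewrite !rowE !mulmxA.
  by rewrite fE tensor_regularE mxvecK fE !mulmxA const_R ?groupV.
have full_f : row_full f.
  rewrite -sub1mx; apply/row_subP=> i.
  suff [v ->] : exists v, row i 1%:M = v *m f by apply: submxMl.
  exists (mxvec (delta_mx (gring_index G 1%g) 0 *m row i 1%:M)).
  rewrite fE mxvecK mulmxA; set c := _ *m delta_mx _ _.
  suff -> : c = 1%:M by rewrite mul1mx.
  apply/matrixP=> i0 j0; rewrite !ord1 !mxE /= (bigD1 (gring_index G 1%g)) //=.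
  rewrite !mxE !eqxx mulr1 big1 ?addr0 // => k nek.
  by rewrite !mxE (negPf nek) mulr0.
have hom1 : mxhom rP rP 1%:M by move=> x _; rewrite mulmx1 mul1mx.
have [l hl lf] := projP _ _ _ _ _ _ homf full_f hom1.
have [e eE]: exists e : 'M_n,
    forall v, v *m e = row (gring_index G 1%g) (vec_mx (v *m l)).
  exists (l *m lin1_mx (row (gring_index G 1%g) \o vec_mx)) => v.
  by rewrite mulmxA mul_rV_lin1.
exists e; apply/row_matrixP=> i; rewrite !rowE mulmx1.
set v := delta_mx 0 i.
rewrite -[RHS]mulmx1 -lf mulmxA fE mulmx_sumr.
transitivity (\sum_(j < #|G|) row j (vec_mx (v *m l))); last first.
  apply/rowP=> k; rewrite summxE !mxE; apply: eq_bigr => j _.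
  by rewrite !mxE mul1r.
rewrite (reindex_onto (fun j : 'I_#|G| => (enum_val j)^-1%g)
          (fun x => gring_index G x^-1)) /=; last first.
  by move=> x Gx; rewrite gring_indexK ?groupV // invgK.
rewrite [LHS](eq_bigl xpredT) => [|j]; last first.
  by rewrite invgK gring_valK eqxx groupV enum_valP.
apply: eq_bigr => j _; have Gj := enum_valP j.
rewrite invgK !mulmxA eE -[v *m _ *m l]mulmxA (hl _ (groupVr Gj)).
rewrite !mulmxA tensor_regularE mxvecK invgK !row_mul rowK -rowE.
rewrite gring_indexK // mul1g gring_valK.
by rewrite -mulmxA -repr_mxM ?groupV // mulVg repr_mx1 mulmx1.
Qed.

End Coaugmented.

(** A linear endomorphism of trace one for G gives one for H by summing its
    conjugates over coset representatives, and such an endomorphism turns any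
    linear lift along f into an equivariant one, by averaging over H. *)
Lemma mxprojective_subg (H : {group gT}) (sHG : H \subset G) n
    (rP : mx_representation F G n) :
  mxprojective rP -> mxprojective (subg_repr rP sHG).
Proof.
move=> projP n1 k rM rN f h homf full_f homh.
have [e tr_e] := mxprojective_trace projP.
have Grepr x : x \in G -> repr (H :* x)%g \in G.
  move=> Gx; have:= mem_repr_rcoset H x; apply: subsetP.
  by rewrite mul_subG ?sub1set.
have [e' tr_e']: exists e' : 'M_n, \sum_(y in H) rP y *m e' *m rP y^-1%g = 1%:M.
  exists (\sum_(C in rcosets H G) rP (repr C) *m e *m rP (repr C)^-1%g).
  rewrite -tr_e [RHS](partition_big (rcoset H)
      (fun C => C \in rcosets H G)) /=; last first.
    by move=> x Gx; apply: imset_f.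
  rewrite (eq_bigr (fun y => \sum_(C in rcosets H G)
    rP (y * repr C)%g *m e *m rP (y * repr C)^-1%g)) => [|y Hy]; last first.
    rewrite mulmx_sumr mulmx_suml; apply: eq_bigr => C /rcosetsP[x Gx ->].
    have Gr := Grepr x Gx.
    have Gy := subsetP sHG y Hy.
    by rewrite invMg !repr_mxM ?groupV // !mulmxA.
  rewrite exchange_big; apply: eq_bigr => C /rcosetsP[x Gx ->].
  have Gr := Grepr x Gx.
  rewrite [RHS](reindex_inj (mulIg (repr (H :* x)%g))) /=.
  apply: eq_bigl => y.
  rewrite rcosetE rcosetM; apply/idP/andP=> [Hy | [_ /eqP eqHx]].
    split; first by rewrite groupM ?Gr ?(subsetP sHG y Hy).
    by rewrite (rcoset_id Hy) rcoset_repr.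
  rewrite -(mulgK (repr (H :* x)%g) y) -mem_rcoset rcoset_repr -{2}eqHx.
  by rewrite -rcosetM rcoset_refl.
have [f' f'f] := row_fullP full_f.
exists (\sum_(y in H) rP y *m (e' *m h *m f') *m rM y^-1%g).
  move=> x Hx; rewrite mulmx_sumr mulmx_suml.
  rewrite [LHS](reindex_inj (mulgI x^-1%g)) /=.
  apply: eq_big => [y|y]; first by rewrite groupMl ?groupV.
  rewrite groupMl ?groupV // => Hy.
  have Gx := subsetP sHG x Hx; have Gy := subsetP sHG y Hy.
  rewrite invMg invgK /= (repr_mxM rP) ?groupV // repr_mxM ?groupV //.
  by rewrite !mulmxA (repr_mxV rP Gx) (mulmxV (repr_mx_unit rP Gx)) mul1mx.
rewrite mulmx_suml -[RHS]mul1mx -tr_e' mulmx_suml; apply: eq_bigr => y Hy.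
rewrite -!mulmxA homf ?groupV // (mulmxA f') f'f mul1mx.
by congr (_ *m (_ *m _)); rewrite [RHS](homh y^-1%g) ?groupV.
Qed.

End Restriction.

(** * Homomorphisms out of a projective cover *)

Section CoverHom.

Variables (F : fieldType) (gT : finGroupType) (G : {group gT}).
Local Notation reprG := (mx_representation F G).

Lemma mxhom_image m n q (rM : reprG m) (rN : reprG n) (h : 'M_(m, n)) (W : 'M_(q, m)) :
  mxhom rM rN h -> mxmodule rM W -> mxmodule rN (W *m h).
Proof.
move=> homh /mxmoduleP modW; apply/mxmoduleP=> x Gx.
by rewrite -mulmxA -homh // mulmxA submxMr ?modW.
Qed.

Lemma mxhom_kermx m n (rM : reprG m) (rN : reprG n) (h : 'M_(m, n)) :
  mxhom rM rN h -> mxmodule rM (kermx h).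
Proof.
move=> homh; apply/mxmoduleP=> x Gx; apply/sub_kermxP.
by rewrite -mulmxA homh // mulmxA mulmx_ker mul0mx.
Qed.

(** W may have any number of rows, so that images and kernels of homomorphisms
    can be used without replacing them by square matrices. *)
Definition simple_repr n (rN : reprG n) :=
  forall q (W : 'M_(q, n)), mxmodule rN W -> W != 0 -> row_full W.

(** The superfluous kernel of the cover lies in the kernel of any h into a
    simple module: otherwise h maps it onto the target, and adding it to
    kermx h gives everything. Hence h factors through f. *)
Lemma cover_hom_factor m n k (rP : reprG m) (rV : reprG n) (rW : reprG k)
    (f : 'M_(m, n)) (h : 'M_(m, k)) :
    mxhom rP rV f -> row_full f ->
    (forall W : 'M_m, mxmodule rP W -> row_full (W + kermx f)%MS -> row_full W) ->
    simple_repr rV -> simple_repr rW -> mxhom rP rW h -> h != 0 ->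
  exists q, [/\ mxhom rV rW q, h = f *m q & n = k].
Proof.
move=> homf full_f small_f simV simW homh nz_h.
have [g gf] := row_fullP full_f.
have full_h : row_full h.
  by apply: simW nz_h; rewrite -[h]mul1mx (mxhom_image homh) ?mxmodule1.
have Kh : kermx f *m h = 0.
  apply/eqP; apply: contraTT nz_h => nz_Kh; rewrite negbK.
  have full_Kh := simW _ _ (mxhom_image homh (mxhom_kermx homf)) nz_Kh.
  suff: row_full (kermx h).
    rewrite -sub1mx => /sub_kermxP; rewrite mul1mx => ->; exact: eqxx.
  apply: small_f; first exact: mxhom_kermx homh.
  have /submxP[Y hY] : (h <= kermx f *m h)%MS by apply: submx_full.
  rewrite -sub1mx -[1%:M](subrK (Y *m kermx f)) addmx_sub_adds ?submxMl //.
  by apply/sub_kermxP; rewrite mulmxBl mul1mx -mulmxA -hY subrr.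
have fgh : f *m g *m h = h.
  apply/eqP; rewrite -subr_eq0 -{2}[h]mul1mx -mulmxBl; apply/eqP.
  have /submxP[Y ->] : (f *m g - 1%:M <= kermx f)%MS.
    by apply/sub_kermxP; rewrite mulmxBl -mulmxA gf mulmx1 mul1mx subrr.
  by rewrite -mulmxA Kh mulmx0.
have homq : mxhom rV rW (g *m h).
  move=> x Gx; rewrite -[rV x]mul1mx -gf -!mulmxA -homh //.
  by congr (_ *m _); rewrite mulmxA -homf // -mulmxA (mulmxA f) fgh.
exists (g *m h); split=> //; first by rewrite mulmxA fgh.
have full_q : row_full (g *m h).
  have : (\rank h <= \rank (g *m h))%N by rewrite -{1}fgh -mulmxA mxrankM_maxr.
  by rewrite (eqP full_h) /row_full eqn_leq rank_leq_col.
have free_q : row_free (g *m h).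
  rewrite -kermx_eq0; apply: contraTT nz_h => nz_ker; rewrite negbK.
  have := simV _ _ (mxhom_kermx homq) nz_ker.
  rewrite -sub1mx => /sub_kermxP; rewrite mul1mx => q0.
  by rewrite -fgh -mulmxA q0 mulmx0.
by rewrite -(eqP full_q); apply/esym/eqP.
Qed.

End CoverHom.

(** * Modules over a group with a distinguished unipotent element *)

Section UnipotentElement.

Variables (F : fieldType) (p : nat) (charFp : p \in [pchar F]).

(** The Frobenius map on polynomials in A: (A - 1)^p = A^p - 1. *)
Lemma unipotent_nilpotent n (A : 'M[F]_n) : A ^+ p = 1 -> (A - 1) ^+ p = 0.
Proof.
case: n A => [|n] A Ap; first by apply/matrixP; case.
have charM : p \in [pchar 'M[F]_n.+1] by rewrite (pchar_lalg 'M[F]_n.+1).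
rewrite -(pFrobenius_autE charM) pFrobenius_autB_comm; last exact: commr1.
by rewrite !pFrobenius_autE Ap expr1n subrr.
Qed.

(** Each further power of A lowers the rank by at most the nullity of A. *)
Lemma nilpotent_size_leq n d (A : 'M[F]_n) j :
  A ^+ j = 0 -> (\rank (cokermx A) <= d)%N -> (n <= j * d)%N.
Proof.
rewrite mxrank_coker => Aj le_d.
have rank_exp i : (n <= \rank (A ^+ i) + i * d)%N.
  elim: i => [|i IHi]; first by rewrite expr0 mxrank1 addn0.
  apply: leq_trans IHi _; rewrite mulSn addnA leq_add2r exprSr.
  rewrite -(mxrank_mul_ker (A ^+ i) A) leq_add2l.
  by rewrite (leq_trans (mxrankS (capmxSr _ _))) // mxrank_ker.
by have := rank_exp j; rewrite Aj mxrank0.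
Qed.

Variables (gT : finGroupType) (G : {group gT}) (g : gT).
Hypotheses (Gg : g \in G) (gp : (g ^+ p = 1)%g).

Lemma repr_nilpotent n (rM : mx_representation F G n) : (rM g - 1) ^+ p = 0.
Proof.
apply: unipotent_nilpotent.
have <- : rM (g ^+ p)%g = rM g ^+ p; last by rewrite gp repr_mx1.
elim: p => [|k IHk]; first by rewrite repr_mx1.
by rewrite expgSr repr_mxM ?groupX // IHk exprSr.
Qed.

(** The columns of Th form a basis of the g-invariant functionals on rM, and
    those of E span the ones on rQ; these functionals are dual to the largest
    quotients on which g acts trivially. The kernel of l on functionals is
    stable under the nilpotent operator g - 1, hence would contain an invariant
    functional if it were not zero; so l maps onto rQ. As g - 1 is nilpotent of
    order at most p, the dimension of rM is at most p times d, which is that of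
    rQ, and l is bijective. *)
Lemma lift_top_rsim n q d (rM : mx_representation F G n)
    (rQ : mx_representation F G q) (Th : 'M_(n, d)) (E : 'M_(q, d)) (l : 'M_(n, q)) :
    (forall th : 'cV_n, rM g *m th = th -> exists y, th = Th *m y) ->
    (forall y : 'cV_d, Th *m y = 0 -> y = 0) ->
    (forall y : 'cV_q, rQ g *m y = y -> exists z, y = E *m z) ->
    q = (p * d)%N -> mxhom rM rQ l -> l *m E = Th ->
  mx_rsim rM rQ.
Proof.
move=> spanM freeM spanQ def_q homl lE.
have inj_l (y : 'cV_q) : l *m y = 0 -> y = 0.
  have : (rQ g - 1) ^+ p *m y = 0 by rewrite repr_nilpotent mul0mx.
  elim: (p) y => [|j IHj] y; first by rewrite expr0 mul1mx.
  rewrite exprSr -mulmxA => Nj ly.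
  have /eqP : (rQ g - 1) *m y = 0.
    apply: IHj Nj _; rewrite mulmxA mulmxBr mulmx1 -homl //.
    by rewrite mulmxBl -mulmxA ly mulmx0 subrr.
  rewrite mulmxBl mul1mx subr_eq0 => /eqP/spanQ[z ez].
  by rewrite ez (freeM z) ?mulmx0 // -lE -mulmxA -ez.
have full_l : row_full l.
  rewrite /row_full -mxrank_tr -[_ == _]/(row_free l^T) -kermx_eq0.
  apply/eqP/row_matrixP=> i; rewrite row0; apply: trmx_inj; rewrite trmx0.
  by apply: inj_l; rewrite -{1}[l]trmxK -trmx_mul -row_mul mulmx_ker row0 trmx0.
have fixC : rM g *m cokermx (rM g - 1) = cokermx (rM g - 1).
  apply/eqP; rewrite -subr_eq0 -{2}[cokermx _]mul1mx -mulmxBl.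
  by rewrite mulmx_coker.
have le_nq : (n <= q)%N.
  rewrite def_q; apply: nilpotent_size_leq (repr_nilpotent rM) _.
  apply: (@leq_trans (\rank Th^T)); last exact: rank_leq_row.
  rewrite -mxrank_tr mxrankS //; apply/row_subP=> i; rewrite -tr_col.
  have [|y ->] := spanM (col i (cokermx (rM g - 1))).
    by rewrite colE mulmxA fixC.
  by rewrite trmx_mul submxMl.
have def_n : n = q.
  by apply/eqP; rewrite eqn_leq le_nq -{1}(eqP full_l) rank_leq_row.
by exists l => //; rewrite /row_free (eqP full_l) def_n.
Qed.

End UnipotentElement.

(** * Sections on which a group element acts by a scalar *)

Section ScalarSection.

Variables (F : fieldType) (gT : finGroupType) (G : {group gT}).
Variables (n : nat) (rG : mx_representation F G n) (U V : 'M[F]_n).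
Variables (modU : mxmodule rG U) (modV : mxmodule rG V).

Lemma section_repr_scalar x c : x \in G ->
  (V *m rG x - c *: V <= U)%MS -> section_repr modU modV x = c%:M.
Proof.
move=> Gx VxU; rewrite -[LHS]mul1mx -[RHS]mulmx1.
apply: val_submod_inj.
rewrite val_submodJ // mul_scalar_mx linearZ /=.
have [Y ->] : exists Y : 'M_(\rank <<in_factmod U V>>%MS, n),
    val_submod (1%:M : 'M_(\rank <<in_factmod U V>>%MS)) = in_factmod U (Y *m V).
  have /submxP[Y ->] : (val_submod (1%:M : 'M_(\rank <<in_factmod U V>>%MS))
      <= in_factmod U V)%MS by rewrite val_submod1 genmxE.
  by exists Y; rewrite /in_factmod /= mulmxA.
rewrite -in_factmodJ // -linearZ /=; apply/eqP; rewrite -subr_eq0 -linearB /=.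
rewrite in_factmod_eq0 -mulmxA scalemxAr -mulmxBr.
exact: mulmx_sub.
Qed.

End ScalarSection.

(** * Matrices of determinant one over the prime field *)

Section Matrices2.

Variable p : nat.
Implicit Types (u v : {'GL_2(p)}) (a b c d : 'F_p).

Lemma ord2P (i : 'I_2) : i = 0 \/ i = 1.
Proof. by case: i => [[|[|//]] ?]; [left | right]; apply: val_inj. Qed.

Lemma mx2P (R : Type) (A B : 'M[R]_2) :
  A 0 0 = B 0 0 -> A 0 1 = B 0 1 -> A 1 0 = B 1 0 -> A 1 1 = B 1 1 -> A = B.
Proof.
by move=> *; apply/matrixP=> i j; case: (ord2P i) (ord2P j) => -> [] ->.
Qed.

Lemma GL_M2E u v i j :
  GLval (u * v)%g i j =
    GLval u i 0 * GLval v 0 j + GLval u i 1 * GLval v 1 j.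
Proof.
rewrite GL_ME mxE big_ord_recl big_ord1.
by have -> : lift ord0 ord0 = 1 :> 'I_2 by apply: val_inj.
Qed.

Lemma SL2_1 : 1%g \in SL2 p.
Proof. by rewrite inE GL_1E det1. Qed.

Lemma SL2M u v : u \in SL2 p -> v \in SL2 p -> (u * v)%g \in SL2 p.
Proof. by rewrite !inE GL_ME det_mulmx => /eqP-> /eqP->; rewrite mulr1. Qed.

Lemma SL2V u : u \in SL2 p -> u^-1%g \in SL2 p.
Proof. by rewrite !inE GL_VE det_inv => /eqP->; rewrite invr1. Qed.

Lemma unip_SL2 : unip p \in SL2 p.
Proof. by have := unip_borel p; rewrite inE => /andP[]. Qed.

Lemma repr_SL2M (F : fieldType) n (rM : mx_representation F (SL2_group p) n) u v :
  u \in SL2 p -> v \in SL2 p -> rM (u * v)%g = rM u *m rM v.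
Proof. by case: rM => f [f1 fM]; apply: fM. Qed.

Lemma repr_SL2_1 (F : fieldType) n (rM : mx_representation F (SL2_group p) n) :
  rM (1%g : {'GL_2(p)}) = 1%:M.
Proof. by case: rM => f [f1 fM]; apply: f1. Qed.

Definition SL2mx a b c d (D : a * d - b * c = 1) : {'GL_2(p)} :=
  FinRing.Unit (unitr_mx2 D).

Lemma SL2mx_SL2 a b c d (D : a * d - b * c = 1) : SL2mx D \in SL2 p.
Proof. by rewrite inE /= det_mx2 D. Qed.

Lemma SL2_det u :
  u \in SL2 p -> GLval u 0 0 * GLval u 1 1 - GLval u 0 1 * GLval u 1 0 = 1.
Proof.
rewrite inE => /eqP <-; rewrite -det_mx2; congr (\det _).
by apply: mx2P; rewrite mxE.
Qed.

Lemma GL2P u v : GLval u 0 0 = GLval v 0 0 -> GLval u 0 1 = GLval v 0 1 ->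
  GLval u 1 0 = GLval v 1 0 -> GLval u 1 1 = GLval v 1 1 -> u = v.
Proof. by move=> *; apply/val_inj/mx2P. Qed.

Definition SL2mxE := (GL_M2E, mxE).

Definition first_col u := (GLval u 0 0, GLval u 1 0).

(** The first column classifies the left cosets of the unipotent subgroup, so
    that these cosets are the nonzero vectors of the plane. *)
Lemma first_col_surj (p_pr : prime p) (w : 'F_p * 'F_p) : w != (0, 0) ->
  exists2 u, u \in SL2 p & first_col u = w.
Proof.
case: w => a c; have [-> | nz_a _] := eqVneq a 0.
  rewrite xpair_eqE eqxx /= => nz_c.
  have D : 0 * 0 - - c^-1 * c = 1 by rewrite mul0r sub0r mulNr opprK mulVf.
  by exists (SL2mx D); rewrite ?SL2mx_SL2 // /first_col !mxE.
have D : a * a^-1 - 0 * c = 1 by rewrite mul0r subr0 mulfV.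
by exists (SL2mx D); rewrite ?SL2mx_SL2 // /first_col !mxE.
Qed.

Lemma SL2_inv_row1 u : u \in SL2 p ->
  (GLval u^-1%g 1 0 = - GLval u 1 0) * (GLval u^-1%g 1 1 = GLval u 0 0).
Proof.
move=> /SL2_det D.
have D' : GLval u 1 1 * GLval u 0 0 - - GLval u 0 1 * - GLval u 1 0 = 1.
  by rewrite mulrNN mulrC.
suff -> : u^-1%g = SL2mx D' by split; rewrite mxE.
apply/eqP; rewrite eq_invg_mul; apply/eqP; apply: GL2P; rewrite !SL2mxE /=.
- by rewrite mulrN D.
- by rewrite mulrN mulrC addNr.
- by rewrite mulrN [X in _ - X]mulrC subrr.
by rewrite mulrN addrC mulrC [GLval u 1 0 * _]mulrC D.
Qed.

End Matrices2.

(** * The modules of binary forms *)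

Lemma leq_ord_max m (i : 'I_m.+1) : (m <= i)%N = (i == ord_max).
Proof. by rewrite -val_eqE /= eqn_leq -[(i <= m)%N]ltnS ltn_ord. Qed.

Section PolynomialCoefficients.

Variable F : fieldType.

Lemma coef_lin_exp (a b : F) n k :
  ((a *: 'X + b%:P) ^+ n)`_k = a ^+ k * b ^+ (n - k) *+ 'C(n, k).
Proof.
have term (i : 'I_n.+1) : (b%:P ^+ (n - i) * (a *: 'X) ^+ i *+ 'C(n, i))`_k
    = a ^+ i * b ^+ (n - i) *+ 'C(n, i) *+ (k == i).
  rewrite -polyC_exp exprZn mul_polyC coefMn !coefZ coefXn.
  by rewrite mulrCA mulr_natr mulrnAr mulrnAC.
rewrite addrC exprDn coef_sum; under eq_bigr do rewrite term.
have [kn | nk] := ltnP k n.+1.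
  rewrite (bigD1 (Ordinal kn)) //= eqxx big1 ?addr0 // => i nei.
  by rewrite eq_sym (negPf (nei : i != k :> nat)).
rewrite bin_small // mulr0n big1 // => i _.
by rewrite gtn_eqF //; apply: leq_trans nk.
Qed.

Lemma size_lin_exp (a b : F) n : (size ((a *: 'X + b%:P) ^+ n)%R <= n.+1)%N.
Proof.
apply/leq_sizeP=> k nk; rewrite coef_lin_exp bin_small //.
Qed.

Lemma coefM_top (P Q : {poly F}) i j :
  (size P <= i.+1)%N -> (size Q <= j.+1)%N -> (P * Q)`_(i + j) = P`_i * Q`_j.
Proof.
move=> sP sQ; have ij: (i < (i + j).+1)%N by rewrite ltnS leq_addr.
rewrite coefM (bigD1 (Ordinal ij)) //= addKn big1 ?addr0 // => k.
rewrite -val_eqE /= neq_ltn => /orP[lt_ki | lt_ik].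
  rewrite (leq_sizeP _ _ sQ) ?mulr0 //.
  by rewrite ltn_subRL ltn_add2r.
by rewrite (leq_sizeP _ _ sP) ?mul0r.
Qed.

End PolynomialCoefficients.

Section Forms.

Variables (F : fieldType) (p : nat) (charFp : p \in [pchar F]).
Implicit Types (u v : {'GL_2(p)}) (a b c d : 'F_p).

Local Notation emb := (@Fp_emb F p).
Let p_pr : prime p := pcharf_prime charFp.

(** Setting y = 1 is injective on forms of a given degree and replaces
    coefficients of bivariate polynomials by those of univariate ones. *)
Lemma VmxE t u (i k : 'I_t) :
  Vmx F t u i k = ((emb (GLval u 0 0) *: 'X + (emb (GLval u 0 1))%:P) ^+ i *
    (emb (GLval u 1 0) *: 'X + (emb (GLval u 1 1))%:P) ^+ (t.-1 - i))`_k.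
Proof.
have t0 : (0 < t)%N by apply: leq_ltn_trans (ltn_ord i).
pose hX (j : 'I_2) : {poly F} := if j == 0 then 'X else 1.
pose dehom := mmap (@polyC F) hX.
have dehomX (j : 'I_t) : dehom 'X_[Vmnm j] = 'X^j.
  rewrite /dehom VmnmE rmorphM !rmorphXn /= !mmapX !mmap1U /hX /= expr1n mulr1.
  by [].
have dehom_lin (a b : F) :
    dehom (a *: 'X_(0 : 'I_2) + b *: 'X_(1 : 'I_2)) = a *: 'X + b%:P.
  by rewrite /dehom mmapD !mmapZ !mmapX !mmap1U /hX /= mulr1 mul_polyC.
have := homog_Vmnm t0 (Vact_homog F u i).
move=> /(congr1 (fun q => (dehom q)`_k)).
rewrite {1}/Vact {1}/dehom rmorphM !rmorphXn /= -/dehom !dehom_lin => ->.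
rewrite /dehom raddf_sum coef_sum (bigD1 k) //= big1 ?addr0 => [|j nej].
  by rewrite mmapZ -/dehom dehomX coefCM coefXn eqxx mulr1 mxE.
rewrite mmapZ -/dehom dehomX coefCM coefXn.
by rewrite val_eqE eq_sym (negPf nej) mulr0.
Qed.

HB.instance Definition _ :=
  GRing.isNmodMorphism.Build 'F_p F emb (conj (Fp_emb0 F p) (Fp_embD charFp)).
HB.instance Definition _ :=
  GRing.isMonoidMorphism.Build 'F_p F emb (conj (Fp_emb1 charFp) (Fp_embM charFp)).

(** Evaluation of forms of degree m at the point w, as a functional. *)
Definition evalV m (w : 'F_p * 'F_p) : 'cV[F]_m.+1 :=
  \col_i (emb w.1 ^+ i * emb w.2 ^+ (m - i)).

(** The form (w.1 y - w.2 x)^m, that is, the m-th power of the determinant of w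
    and the generic vector. *)
Definition detV m (w : 'F_p * 'F_p) : 'rV[F]_m.+1 :=
  \row_i ((- emb w.2) ^+ i * emb w.1 ^+ (m - i) *+ 'C(m, i)).

(** The coefficient of x^m is the value at (1, 0). *)
Lemma Vmx_lastcol m u : Vmx F m.+1 u *m delta_mx ord_max 0 = evalV m (first_col u).
Proof.
apply/colP=> i; rewrite -colE [LHS]mxE VmxE [RHS]mxE /=.
have im : (i <= m)%N by rewrite -ltnS.
rewrite -[X in _`_X](subnKC im) coefM_top ?size_lin_exp // !coef_lin_exp.
by rewrite !subnn !expr0 !mulr1 !binn !mulr1n.
Qed.

Lemma Vmx_firstrow m u : u \in SL2 p ->
  delta_mx 0 ord0 *m Vmx F m.+1 u^-1%g = detV m (first_col u).
Proof.
move=> Gu; apply/rowP=> k; rewrite -rowE [LHS]mxE VmxE [RHS]mxE /= expr0 mul1r subn0.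
by rewrite coef_lin_exp !SL2_inv_row1 // rmorphN.
Qed.

Lemma Vmx_unip m (i k : 'I_m.+1) : Vmx F m.+1 (unip p) i k = 'C(i, k)%:R.
Proof.
rewrite VmxE !mxE /= !(rmorph0, rmorph1) scale0r add0r scale1r expr1n mulr1.
by rewrite -[X in X + _]scale1r coef_lin_exp !expr1n mulr1.
Qed.

Lemma Vmx_torus m z (i k : 'I_m.+1) :
  Vmx F m.+1 (torus z) i k =
    (emb (val z) ^+ i * emb (val z)^-1 ^+ (m - i)) *+ (i == k).
Proof.
rewrite VmxE !mxE /= !(rmorph0) scale0r add0r addr0 -rmorphXn mulrC.
rewrite mul_polyC exprZn scalerA coefZ coefXn -[RHS]mulr_natr eq_sym.
by rewrite [X in X * _]mulrC.
Qed.

Lemma pchar_natr_neq0 k : (0 < k < p)%N -> k%:R != 0 :> F.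
Proof. by case/andP=> k0 kp; rewrite -(dvdn_pcharf charFp) gtnNdvd. Qed.

(** Subtracting the identity from the action of the unipotent generator lowers
    the top index of a vector by exactly one, because the entries just below the
    diagonal are the integers 1, ..., m, which are nonzero as long as the degree
    m stays below p. *)
Lemma unip_stable_flag m q (W : 'M[F]_(q, m.+1)) (v : 'rV[F]_m.+1) (r : 'I_m.+1) :
    (m < p)%N -> (W *m Vmx F m.+1 (unip p) <= W)%MS -> (v <= W)%MS ->
    v 0 r != 0 -> (forall j : 'I_m.+1, (r < j)%N -> v 0 j = 0) ->
  forall j : 'I_m.+1, (j <= r)%N -> ((delta_mx 0 j : 'rV_m.+1) <= W)%MS.
Proof.
move=> mp Wg; case: r => r; elim: r v => [|r IHr] v rm vW /= vr v0 j jr.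
  have -> : j = Ordinal rm by apply/val_inj/eqP; rewrite -leqn0.
  rewrite -(eqmx_scale _ vr); apply: submx_trans vW.
  rewrite (_ : _ *: _ = v) ?submx_refl //; apply/rowP=> k; rewrite !mxE /=.
  have [-> | nk] := eqVneq k (Ordinal rm); first by rewrite mulr1.
  by rewrite mulr0 v0 //= lt0n.
pose w := v *m Vmx F m.+1 (unip p) - v.
have rm' : (r < m.+1)%N by apply: ltnW.
have wW : (w <= W)%MS.
  rewrite addmx_sub ?eqmx_opp //; apply: submx_trans Wg; exact: submxMr.
have wE k : w 0 k = \sum_(i < m.+1 | (k < i)%N) v 0 i * 'C(i, k)%:R.
  rewrite !mxE (bigID (fun i : 'I_m.+1 => (k < i)%N)) /= -addrA.
  rewrite [X in _ + (X - _)](bigD1 k) ?ltnn //=.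
  rewrite [X in _ + (_ + X - _)]big1 => [|i /andP[ik nik]].
    rewrite Vmx_unip binn mulr1 addr0 subrr addr0.
    by apply: eq_bigr => i _; rewrite Vmx_unip.
  rewrite Vmx_unip bin_small ?mulr0 // ltn_neqAle nik.
  by rewrite leqNgt ik.
have w_r : w 0 (Ordinal rm') != 0.
  rewrite wE (bigD1 (Ordinal rm)) //= big1 => [|i /andP[ri nir]].
    by rewrite addr0 binSn mulf_neq0 // pchar_natr_neq0 // (leq_trans rm) // ltnS.
  rewrite v0 ?mul0r //= ltn_neqAle ri andbT.
  by rewrite eq_sym -[r.+1]/(val (Ordinal rm)) val_eqE.
have w0 (k : 'I_m.+1) : (r < k)%N -> w 0 k = 0.
  move=> rk; rewrite wE big1 // => i ki; rewrite v0 ?mul0r //.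
  exact: leq_ltn_trans ki.
have lower := IHr w rm' wW w_r w0.
move: jr; rewrite leq_eqVlt => /orP[/eqP jr | ]; last first.
  by rewrite ltnS; apply: lower.
have -> : j = Ordinal rm by apply: val_inj.
rewrite -(eqmx_scale _ vr).
have -> : v 0 (Ordinal rm) *: delta_mx 0 (Ordinal rm) =
    v - \sum_(i < m.+1 | (i <= r)%N) v 0 i *: delta_mx 0 i.
  rewrite {2}(row_sum_delta v) (bigID (fun i : 'I_m.+1 => (i <= r)%N)) /=.
  rewrite addrC addrK (bigD1 (Ordinal rm)) ?ltnn //= big1 ?addr0 // => i.
  case/andP; rewrite -ltnNge => ri nir; rewrite v0 ?scale0r //=.
  rewrite ltn_neqAle ri andbT.
  by rewrite eq_sym -[r.+1]/(val (Ordinal rm)) val_eqE.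
rewrite addmx_sub // eqmx_opp summx_sub // => i ir.
by apply: scalemx_sub; apply: lower.
Qed.

Lemma max_support m (v : 'rV[F]_m.+1) : v != 0 ->
  exists2 r, v 0 r != 0 & forall j : 'I_m.+1, (r < j)%N -> v 0 j = 0.
Proof.
move=> nz_v; have [i0 vi0] : exists i, v 0 i != 0.
  apply/existsP; apply: contraR nz_v; rewrite negb_exists => /forallP v0.
  by apply/eqP/rowP=> i; rewrite mxE; apply/eqP; rewrite -[_ == _]negbK.
have [r vr max_r] :=
  arg_maxnP (fun i : 'I_m.+1 => i : nat) (vi0 : (fun i => v 0 i != 0) i0).
exists r => // j rj; apply/eqP; apply: contraTT rj => vj.
by rewrite -leqNgt; apply: max_r.
Qed.

Lemma unip_stable_delta0 m q (W : 'M[F]_(q, m.+1)) :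
    (m < p)%N -> (W *m Vmx F m.+1 (unip p) <= W)%MS -> W != 0 ->
  ((delta_mx 0 ord0 : 'rV_m.+1) <= W)%MS.
Proof.
move=> mp Wg nzW; have [i nz_i] : exists i, row i W != 0.
  apply/existsP; apply: contraR nzW; rewrite negb_exists => /forallP W0.
  apply/eqP/row_matrixP=> i; rewrite row0; apply/eqP.
  by rewrite -[_ == _]negbK.
have [r vr v0] := max_support nz_i.
exact: (unip_stable_flag mp Wg (row_sub i W) vr v0).
Qed.

(** The lowest monomial of a nonzero submodule is carried by the Weyl element
    to the highest one, from which the unipotents reach all the others. *)
Lemma Vrepr_simple m q (W : 'M[F]_(q, m.+1)) :
  (m < p)%N -> mxmodule (Vrepr charFp m.+1) W -> W != 0 -> row_full W.
Proof.
move=> mp /mxmoduleP modW nzW.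
have modV u : u \in SL2 p -> (W *m Vmx F m.+1 u <= W)%MS by exact: modW.
have Wg : (W *m Vmx F m.+1 (unip p) <= W)%MS.
  exact: modV (unip_SL2 p).
have nz_w : (0, -1) != (0, 0) :> 'F_p * 'F_p.
  by rewrite xpair_eqE oppr_eq0 oner_eq0 andbF.
have [u Gu fu] := first_col_surj p_pr nz_w; have GuV := SL2V Gu.
have e0W := unip_stable_delta0 mp Wg nzW.
have emW : ((delta_mx 0 ord_max : 'rV_m.+1) <= W)%MS.
  have := submx_trans (submxMr _ e0W) (modV _ GuV).
  rewrite Vmx_firstrow // fu; apply: submx_trans.
  rewrite (_ : detV _ _ = delta_mx 0 ord_max) //; apply/rowP=> i.
  rewrite mxE [in RHS]mxE [emb _.2]rmorphN rmorph1 opprK expr1n mul1r.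
  rewrite [emb _.1]rmorph0 expr0n subn_eq0 leq_ord_max.
  by case: eqP => [->|] //=; rewrite ?binn ?mul0rn.
rewrite -sub1mx; apply/row_subP=> i; rewrite row1.
apply: (unip_stable_flag (r := ord_max) mp Wg emW); last exact: leq_ord.
  by rewrite mxE !eqxx oner_neq0.
by move=> j /=; rewrite ltnNge leq_ord.
Qed.

(** * The plane over the prime field *)

Lemma emb_expp1 c : c != 0 -> emb c ^+ p.-1 = 1.
Proof.
move=> nz_c; rewrite -rmorphXn.
have -> : c ^+ p.-1 = 1; last exact: rmorph1.
apply: (mulIf nz_c); rewrite -exprSr mul1r prednK ?prime_gt0 //.
by rewrite -[X in c ^+ X](card_Fp p_pr) expf_card.
Qed.

(** If c^k differs from 1 for some nonzero c, multiplying the variable by c shows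
    that the sum vanishes; such a c exists for 0 < k < p - 1, and larger
    exponents are reduced by Fermat's little theorem. *)
Lemma sum_emb_exp k : (k < p.-1.*2)%N ->
  \sum_(c : 'F_p) emb c ^+ k = - 1 *+ (k == p.-1).
Proof.
have p1_gt0 : (0 < p.-1)%N by rewrite -ltnS prednK ?prime_gt0 ?prime_gt1.
have small k' : (k' < p.-1)%N -> \sum_(c : 'F_p) emb c ^+ k' = 0.
  case: k' => [_ | k' lt_k].
    by rewrite sumr_const card_Fp // pcharf0.
  have [c nz_c ck] : exists2 c : 'F_p, c != 0 & c ^+ k'.+1 != 1.
    apply/exists_inP; apply: contraLR lt_k.
    rewrite negb_exists_in => /forall_inP ck.
    have nz : 'X^(k'.+1) - 1 != 0 :> {poly 'F_p}.
      by rewrite -size_poly_eq0 size_XnsubC.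
    have := max_poly_roots nz (_ : all _ (enum [pred c : 'F_p | c != 0])).
    rewrite size_XnsubC // enum_uniq -cardE cardC1 card_Fp // -leqNgt -ltnS.
    apply=> //; apply/allP=> c; rewrite mem_enum => /ck; rewrite negbK => /eqP.
    by move=> ck1; rewrite rootE !hornerE ck1 subrr.
  apply/eqP; rewrite -(mulIr_eq0 _ (mulIf (_ : emb c ^+ k'.+1 - 1 != 0))).
    rewrite mulrBr mulr1 mulr_suml subr_eq0; apply/eqP.
    rewrite [RHS](reindex_inj (mulIf nz_c)); apply: eq_bigr => d _.
    by rewrite rmorphM exprMn.
  by rewrite subr_eq0 -rmorphXn -(Fp_emb1 charFp) (inj_eq (fmorph_inj _)).
have [| p1k k2] := ltnP k p.-1; first by move=> kp; rewrite small ?ltn_eqF.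
have [-> | nk] := eqVneq k p.-1.
  rewrite (bigD1 0) //= rmorph0 expr0n gtn_eqF // add0r.
  rewrite (eq_bigr (fun _ => 1)) => [|c /emb_expp1 //].
  rewrite sumr_const cardC1 card_Fp // -[X in X%:R](addKn 1) add1n.
  by rewrite prednK ?prime_gt0 // natrB ?prime_gt0 // pcharf0 // sub0r.
rewrite mulr0n -[RHS](small (k - p.-1)%N); last first.
  by rewrite ltn_subLR // addnn.
apply: eq_bigr => c _; have [-> | nz_c] := eqVneq c 0.
  rewrite rmorph0 !expr0n subn_eq0 gtn_eqF ?(leq_trans p1_gt0) //.
  by rewrite leqNgt ltn_neqAle eq_sym nk p1k.
by rewrite -{1}(subnK p1k) exprD emb_expp1 ?mulr1.
Qed.

Lemma sum_pairs (f g : 'F_p -> F) :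
  \sum_(w : 'F_p * 'F_p) f w.1 * g w.2 = (\sum_a f a) * (\sum_c g c).
Proof.
rewrite big_distrlr /= pair_big; exact: eq_bigr.
Qed.

Lemma unip_expE k : GLval (unip p ^+ k)%g = mx2 1 k%:R 0 1.
Proof.
elim: k => [|k IHk]; first by apply: mx2P; rewrite ?expg0 ?GL_1E !mxE.
apply: mx2P; rewrite expgSr GL_M2E IHk !mxE /=.
- by rewrite mulr0 addr0 mulr1.
- by rewrite !mulr1 -natr1 addrC.
- by rewrite mul0r add0r mulr0.
by rewrite mul0r add0r mulr1.
Qed.

Lemma first_col10_unip u : u \in SL2 p -> first_col u = (1, 0) ->
  u = (unip p ^+ (GLval u 0%R 1%R : nat))%g.
Proof.
move=> Gu [u00 u10]; have := SL2_det Gu; rewrite u00 u10 mulr0 subr0 mul1r => u11.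
apply: GL2P; rewrite unip_expE mxE /= ?u00 ?u10 ?u11 //.
by rewrite natr_Zp.
Qed.

(** A representative in SL_2 of the coset attached to a nonzero vector; the
    default value 1 serves for the zero vector only. *)
Definition col_lift (w : 'F_p * 'F_p) : {'GL_2(p)} :=
  odflt 1%g [pick u in SL2 p | first_col u == w].

Lemma col_liftP w : w != (0, 0) -> col_lift w \in SL2 p /\ first_col (col_lift w) = w.
Proof.
move=> nz_w; rewrite /col_lift; case: pickP => [u /andP[Gu /eqP] //|].
by have [u Gu <-] := first_col_surj p_pr nz_w; move/(_ u); rewrite Gu eqxx.
Qed.

Definition plane_act u (w : 'F_p * 'F_p) : 'F_p * 'F_p :=
  (GLval u 0 0 * w.1 + GLval u 0 1 * w.2, GLval u 1 0 * w.1 + GLval u 1 1 * w.2).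

Lemma first_colM u v : first_col (u * v)%g = plane_act u (first_col v).
Proof. by rewrite /first_col !GL_M2E. Qed.

Lemma plane_actM u v w : plane_act (u * v)%g w = plane_act u (plane_act v w).
Proof.
by rewrite /plane_act !GL_M2E /= !mulrDl !mulrDr !mulrA; congr (_, _);
  rewrite -!addrA; congr (_ + _); rewrite addrCA.
Qed.

Lemma plane_actK u : cancel (plane_act u) (plane_act u^-1%g).
Proof.
move=> [a c]; rewrite -plane_actM mulVg /plane_act GL_1E !mxE /=.
by rewrite !mul1r !mul0r addr0 add0r.
Qed.

Lemma plane_act_eq0 u w : (plane_act u w == (0, 0)) = (w == (0, 0)).
Proof.
have act0 : plane_act u (0, 0) = (0, 0) by rewrite /plane_act /= !mulr0 addr0.
by rewrite -{1}act0 (inj_eq (can_inj (plane_actK u))).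
Qed.

Lemma first_col_neq0 u : u \in SL2 p -> first_col u != (0, 0).
Proof.
move/SL2_det => D; apply: contra_eq_neq D => [[-> ->]].
by rewrite mul0r mulr0 subrr eq_sym oner_neq0.
Qed.

(** * The form-valued trace of a unipotent invariant functional *)

Section RelativeTrace.

Variables (n : nat) (rM : mx_representation F (SL2_group p) n) (th : 'cV[F]_n).

(** When th is invariant under the unipotents, its translate by x depends only
    on the first column of x, hence is a function on the nonzero vectors w. *)
Definition orbit_cV w : 'cV[F]_n := rM (col_lift w) *m th.

(** The trace, relative to the subgroup of unipotents, of the rank-one map
    v |-> th(v) y^m. The sum runs over cosets since a sum over the whole group
    would be divisible by p. *)
Definition trace_form m : 'M[F]_(n, m.+1) :=
  \sum_(w | w != (0, 0)) orbit_cV w *m detV m w.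

Hypothesis th_unip : rM (unip p) *m th = th.

Lemma orbit_cV_first_col u : u \in SL2 p -> rM u *m th = orbit_cV (first_col u).
Proof.
move=> Gu; have [Gl fl] := col_liftP (first_col_neq0 Gu); set l := col_lift _ in Gl fl.
have unipX k : (unip p ^+ k)%g \in SL2 p /\ rM (unip p ^+ k)%g *m th = th.
  elim: k => [|k [Gk IHk]].
    by rewrite expg0 SL2_1 repr_SL2_1 mul1mx.
  have Gunip := unip_SL2 p.
  by rewrite expgSr SL2M // repr_SL2M // -mulmxA th_unip.
have Gv : (l^-1 * u)%g \in SL2 p by rewrite SL2M ?SL2V.
have fv : first_col (l^-1 * u)%g = (1, 0).
  by rewrite first_colM -fl -first_colM mulVg /first_col GL_1E !mxE.
rewrite -[u in LHS](mulKVg l) repr_SL2M // -mulmxA (first_col10_unip Gv fv).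
by have [_ ->] := unipX (GLval (l^-1 * u)%g 0 1 : nat).
Qed.

Lemma orbit_cV10 : orbit_cV (1, 0) = th.
Proof.
have <- : first_col (1%g : {'GL_2(p)}) = (1, 0) by rewrite /first_col GL_1E !mxE.
by rewrite -orbit_cV_first_col ?SL2_1 // repr_SL2_1 mul1mx.
Qed.

Lemma orbit_cV_act u w : u \in SL2 p -> w != (0, 0) ->
  rM u *m orbit_cV w = orbit_cV (plane_act u w).
Proof.
move=> Gu nz_w; have [Gl fl] := col_liftP nz_w.
by rewrite mulmxA -repr_SL2M // orbit_cV_first_col ?SL2M // first_colM fl.
Qed.

(** The translate of y^m by the inverse of x is the determinant form of the
    first column of x; equivariance is then a change of variable in the sum. *)
Lemma trace_form_hom m : mxhom rM (Vrepr charFp m.+1) (trace_form m).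
Proof.
move=> u Gu; have GuV := SL2V Gu.
have detV_act w : w != (0, 0) ->
    detV m w *m Vrepr charFp m.+1 u = detV m (plane_act u^-1%g w).
  move=> nz_w; have [Gl fl] := col_liftP nz_w.
  rewrite -{1}fl -Vmx_firstrow // -mulmxA -[Vmx _ _ _]/(Vrepr charFp m.+1 _).
  rewrite -repr_SL2M ?SL2V // -[u in LHS]invgK -invMg.
  by rewrite [LHS]Vmx_firstrow ?SL2M // first_colM fl.
rewrite mulmx_sumr mulmx_suml [RHS](reindex_inj (can_inj (plane_actK u))) /=.
apply: eq_big => [w | w nz_w]; first by rewrite plane_act_eq0.
rewrite mulmxA orbit_cV_act // -[RHS]mulmxA.
by rewrite detV_act ?plane_act_eq0 // plane_actK.
Qed.

End RelativeTrace.

(** A polynomial of degree less than p is zero if it vanishes on the prime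
    field. *)
Lemma evalV_span m q (D : 'M[F]_(q, m.+1)) :
  (m < p)%N -> (forall c, D *m evalV m (c, 1) = 0) -> D = 0.
Proof.
move=> mp D0; apply/matrixP=> i j; rewrite mxE.
pose P := \poly_(k < m.+1) D i (inord k).
suff P0: P = 0.
  have := congr1 (fun Q : {poly F} => Q`_j) P0.
  by rewrite coef_poly coef0 ltn_ord inord_val.
apply/eqP; apply: contraTT mp => nzP.
have := max_poly_roots nzP (_ : all _ [seq emb c | c : 'F_p]).
rewrite size_image card_Fp // map_inj_uniq ?enum_uniq; last exact: fmorph_inj.
rewrite -leqNgt => lt_p; apply: leq_trans (lt_p _ isT) (size_poly _ _).
apply/allP=> _ /imageP[c _ ->]; rewrite rootE horner_poly.
have /colP/(_ i) := D0 c; rewrite !mxE => Dc; apply/eqP; rewrite -[RHS]Dc.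
by apply: eq_bigr => k _; rewrite !mxE inord_val rmorph1 expr1n mulr1.
Qed.

Lemma evalV_act m u w : u \in SL2 p -> w != (0, 0) ->
  Vmx F m.+1 u *m evalV m w = evalV m (plane_act u w).
Proof.
move=> Gu nz_w; have [Gl fl] := col_liftP nz_w.
rewrite -{1}fl -Vmx_lastcol mulmxA -[Vmx _ _ u]/(Vrepr charFp m.+1 u).
by rewrite -[Vmx _ _ _]/(Vrepr charFp m.+1 _) -repr_SL2M // [LHS]Vmx_lastcol first_colM fl.
Qed.

Lemma evalV_scale m d w :
  evalV m (d * w.1, d * w.2) = emb d ^+ m *: evalV m w.
Proof.
apply/colP=> i; rewrite !mxE /= !rmorphM !exprMn mulrACA -exprD subnKC //.
by rewrite -ltnS.
Qed.

Lemma evalV10 m : evalV m (1, 0) = delta_mx ord_max 0.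
Proof.
apply/colP=> i; rewrite !mxE /= rmorph1 expr1n mul1r rmorph0 expr0n subn_eq0.
by rewrite andbT leq_ord_max.
Qed.

(** A sum over the nonzero vectors of the plane of a function of lines counts
    each of the p + 1 lines p - 1 = -1 times. *)
Lemma sum_lines n (G : 'F_p * 'F_p -> 'cV[F]_n) :
  (forall d w, d != 0 -> w != (0, 0) -> G (d * w.1, d * w.2) = G w) ->
  \sum_(w | w != (0, 0)) G w = - (G (1, 0) + \sum_c G (c, 1)).
Proof.
move=> Gd; have p1E : (p.-1)%:R = -1 :> F.
  by rewrite -subn1 natrB ?prime_gt0 // pcharf0 // sub0r.
have cst (v : 'cV[F]_n) : \sum_(d : 'F_p | d != 0) v = - v.
  by rewrite sumr_const cardC1 card_Fp // -scaler_nat p1E scaleN1r.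
rewrite (bigID (fun w : 'F_p * 'F_p => w.2 == 0)) /= opprD; congr (_ + _).
  rewrite -cst [RHS](eq_bigr (fun d => G (d, 0))) => [|d nz_d]; last first.
    by rewrite -(Gd d (1, 0)) ?xpair_eqE ?oner_eq0 //= mulr1 mulr0.
  rewrite (reindex_onto (fun d => (d, 0)) fst) /= => [|[a c] /andP[_ /eqP /= -> //]].
  by apply: eq_bigl => d; rewrite xpair_eqE !eqxx !andbT.
rewrite -cst.
transitivity (\sum_a \sum_(c | c != 0) G (a, c)).
  rewrite pair_big_dep; apply: eq_big => [] [a c] //=.
  by rewrite xpair_eqE /= negb_and andb_orl andbb orb_idl // => /andP[].
rewrite exchange_big /=; apply: eq_bigr => d nz_d.
rewrite (reindex_inj (mulfI nz_d)); apply: eq_bigr => c _.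
by rewrite -[RHS](Gd d) ?xpair_eqE ?oner_eq0 ?andbF //= mulr1.
Qed.

(** The Vandermonde matrix of the elements of the prime field is invertible. *)
Lemma interpolation n (G : 'F_p -> 'cV[F]_n) :
  exists A : nat -> 'cV[F]_n,
    forall c, G c = \sum_(i < p) emb c ^+ i *: A i.
Proof.
pose a : 'rV[F]_(Zp_trunc (pdiv p)).+2 := \row_c emb c.
have unitW : Vandermonde (Zp_trunc (pdiv p)).+2 a \in unitmx.
  rewrite unitmxE unitfE det_Vandermonde.
  apply/prodf_neq0 => i _; apply/prodf_neq0 => j lt_ij.
  rewrite !mxE subr_eq0 (inj_eq (fmorph_inj _)).
  by apply: contraTneq lt_ij => ->; rewrite ltnn.
pose Phi := \matrix_(x < n, c < (Zp_trunc (pdiv p)).+2) G c x 0.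
pose A := Phi *m invmx (Vandermonde (Zp_trunc (pdiv p)).+2 a).
have AW : A *m _ = Phi := mulmxKV unitW Phi.
exists (fun i => col (inord i) A) => c.
have sum_p (f : nat -> 'cV[F]_n) :
    \sum_(i < p) f i = \sum_(i < (Zp_trunc (pdiv p)).+2) f i.
  by rewrite -!(big_mkord xpredT f) Fp_cast.
rewrite (sum_p (fun i => emb c ^+ i *: col (inord i) A)).
apply/colP=> x; have /matrixP/(_ x c) := AW; rewrite !mxE summxE => <-.
apply: eq_bigr => i _; rewrite !mxE inord_val mulrC.
by [].
Qed.

Lemma pchar_bin_neq0 m i : (i <= m)%N -> (m < p)%N -> 'C(m, i)%:R != 0 :> F.
Proof.
have fact_neq0 n : (n < p)%N -> n`!%:R != 0 :> F.
  elim: n => [|n IHn] lt_np; first exact: oner_neq0.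
  by rewrite factS natrM mulf_neq0 ?IHn ?pchar_natr_neq0 // ltnW.
move=> le_im lt_mp; have := fact_neq0 m lt_mp.
by rewrite -(bin_fact le_im) natrM mulf_eq0 negb_or => /andP[].
Qed.

(** Such functionals are the homomorphisms from the restriction of rM to the
    Borel subgroup to its one-dimensional module of weight k. *)
Definition borel_weight n (rM : mx_representation F (SL2_group p) n) (th : 'cV[F]_n) k :=
  forall u, u \in borel p -> rM u *m th = emb (GLval u 0 0) ^+ k *: th.

Section BorelWeight.

Variables (n : nat) (rM : mx_representation F (SL2_group p) n).
Variables (th : 'cV[F]_n) (k : nat).
Hypothesis th_k : borel_weight rM th k.

Lemma borel_weight_unip : rM (unip p) *m th = th.
Proof. by rewrite th_k ?unip_borel // mxE /= rmorph1 expr1n scale1r. Qed.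

Lemma orbit_cV_scale d w : d != 0 -> w != (0, 0) ->
  orbit_cV rM th (d * w.1, d * w.2) = emb d ^+ k *: orbit_cV rM th w.
Proof.
move=> nz_d nz_w; have [Gl fl] := col_liftP nz_w.
have D : d * d^-1 - 0 * 0 = 1 by rewrite mulr0 subr0 mulfV.
have Gb := SL2mx_SL2 D; have Bb : SL2mx D \in borel p.
  by rewrite inE Gb mxE /=.
have -> : (d * w.1, d * w.2) = first_col (col_lift w * SL2mx D)%g.
  have fd : first_col (SL2mx D) = (d, 0) by rewrite /first_col !mxE.
  have w1 : GLval (col_lift w) 0 0 = w.1 := congr1 fst fl.
  have w2 : GLval (col_lift w) 1 0 = w.2 := congr1 snd fl.
  by rewrite first_colM fd /plane_act /= !mulr0 !addr0 w1 w2 ![_ * d]mulrC.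
rewrite -(orbit_cV_first_col borel_weight_unip) ?SL2M // repr_SL2M // -mulmxA.
by rewrite th_k // mxE /= -scalemxAr.
Qed.

(** For every v, the map sending a vector w = x (1, 0), with x in SL_2, to
    th(v x) is homogeneous of degree k. The coefficients of the trace are its
    moments of degree m = p - 1 - k, up to nonzero factors. On the chart
    w = (c, 1), the map is interpolated by a polynomial of degree less than p,
    and the vanishing moments are the coefficients of this polynomial in
    degrees above k, together with the discrepancy between its coefficient of
    degree k and the value at (1, 0). Hence the map is a form of degree k, and
    this form depends equivariantly on v. *)
Lemma trace_form_eq0 m : (0 < k)%N -> (k + m)%N = p.-1 ->
    trace_form rM th m = 0 ->
  exists2 h : 'M_(n, k.+1), mxhom rM (Vrepr charFp k.+1) h &
    h *m delta_mx ord_max 0 = th.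
Proof.
move=> k0 km tr0; set f := orbit_cV rM th.
have kp : (k < p)%N by rewrite -(prednK (prime_gt0 p_pr)) ltnS -km leq_addr.
have mp : (m < p)%N by rewrite -(prednK (prime_gt0 p_pr)) ltnS -km leq_addl.
have moment j : (j <= m)%N ->
    \sum_c emb c ^+ j *: f (c, 1) = - (f (1, 0) *+ (j == m)).
  (* The moments of the vanishing trace are sums over all nonzero vectors; the
     integrand is invariant under scaling because k + m = p - 1. *)
  move=> jm; pose i : 'I_m.+1 := inord (m - j).
  have iE : i = (m - j)%N :> nat by rewrite inordK // ltnS leq_subr.
  pose G w := emb w.2 ^+ i *: (emb w.1 ^+ j *: f w).
  have Gd d w : d != 0 -> w != (0, 0) -> G (d * w.1, d * w.2) = G w.
    move=> nz_d nz_w; rewrite /G /= /f orbit_cV_scale // !rmorphM !exprMn !scalerA.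
    congr (_ *: _).
    have -> : emb d ^+ i * emb w.2 ^+ i * (emb d ^+ j * emb w.1 ^+ j) * emb d ^+ k =
      emb d ^+ p.-1 * (emb w.2 ^+ i * emb w.1 ^+ j).
      have -> : p.-1 = (i + j + k)%N by rewrite iE subnK // addnC.
      by rewrite !exprD; ring.
    by rewrite emb_expp1 // mul1r.
  have sumG : \sum_(w | w != (0, 0)) G w = 0.
    have := congr1 (fun T => col i T) tr0; rewrite raddf0 => col_i.
    apply/(scalerI (_ : ((-1) ^+ i *+ 'C(m, i) : F) != 0)).
      rewrite -mulr_natr mulf_neq0 ?signr_eq0 //.
      by rewrite pchar_bin_neq0 // iE leq_subr.
    rewrite scaler0 -[RHS]col_i /trace_form /= scaler_sumr [RHS]linear_sum /=.
    apply: eq_bigr => w _; apply/colP=> x.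
    rewrite !mxE big_ord1 !mxE iE subKn //.
    rewrite [(- emb _) ^+ _]exprNn.
    rewrite -[X in X * _ = _]mulr_natr -[X in _ = _ * X]mulr_natr.
    ring.
  have /eqP := sum_lines Gd; rewrite sumG eq_sym oppr_eq0 addrC addr_eq0 => /eqP G1.
  have -> : \sum_c emb c ^+ j *: f (c, 1) = \sum_c G (c, 1).
    by apply: eq_bigr => c _; rewrite /G /= rmorph1 expr1n scale1r.
  rewrite G1 /G /= !rmorph1 rmorph0 !expr1n scale1r expr0n iE subn_eq0.
  by rewrite eqn_leq jm; case: (m <= j)%N; rewrite ?scale1r ?scale0r.
have [A fA] := interpolation (fun c => f (c, 1)).
have momentA j : (j < p.-1)%N -> \sum_c emb c ^+ j *: f (c, 1) = - A (p.-1 - j)%N.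
  move=> jp; under eq_bigr => c _ do rewrite fA scaler_sumr.
  rewrite exchange_big /=.
  under eq_bigr => i _ do
    under eq_bigr => c _ do rewrite scalerA -exprD.
  under eq_bigr => i _ do rewrite -scaler_suml.
  have ip : (p.-1 - j < p)%N.
    by rewrite ltn_subLR ?(ltnW jp) // ltn_addl // ltn_predL prime_gt0.
  rewrite (bigD1 (Ordinal ip)) //= [X in _ + X]big1 ?addr0 => [|i ne_i].
    rewrite subnKC ?(ltnW jp) // sum_emb_exp ?eqxx ?scaleN1r //.
    by rewrite -addnn -[X in (X < _)%N]addn0 ltn_add2l (leq_ltn_trans _ jp).
  rewrite sum_emb_exp; last first.
    by rewrite -addnn -addSn leq_add // -ltnS prednK ?prime_gt0.
  case: eqP => [ji|_]; last by rewrite scale0r.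
  by case/eqP: ne_i; apply: val_inj; rewrite /= -ji addKn.
have jmp j : (j <= m)%N -> (j < p.-1)%N.
  by move/leq_ltn_trans; apply; rewrite -km -[X in (X < _)%N]add0n ltn_add2r.
have Ak : A k = f (1, 0).
  have := moment m (leqnn m); rewrite momentA ?jmp // eqxx mulr1n => /oppr_inj <-.
  by rewrite -km addnK.
have A0 i : (k < i < p)%N -> A i = 0.
  case/andP=> ki ip; have ip1 : (i <= p.-1)%N by rewrite -ltnS prednK ?prime_gt0.
  have jm : (p.-1 - i < m)%N by rewrite ltn_subLR // -km ltn_add2r.
  apply: oppr_inj; rewrite -{1}(subKn ip1) -momentA ?jmp ?(ltnW jm) //.
  by rewrite moment ?(ltnW jm) // (ltn_eqF jm) mulr0n.
(* By A0, truncating the interpolating polynomial after degree k loses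
   nothing. *)
pose h := \matrix_(x < n, i < k.+1) A i x 0.
have hE w : w != (0, 0) -> h *m evalV k w = f w.
  have h10 : h *m evalV k (1, 0) = f (1, 0).
    by rewrite evalV10 -Ak -colE; apply/colP=> x; rewrite !mxE.
  have hc1 c : h *m evalV k (c, 1) = f (c, 1).
    rewrite fA -(big_mkord xpredT (fun i => emb c ^+ i *: A i)).
    rewrite (big_cat_nat _ (n := k.+1)) //= [X in _ + X]big_nat_cond.
    rewrite [X in _ + X]big1 ?addr0 => [|i]; last first.
      by rewrite andbT => /A0->; rewrite scaler0.
    rewrite big_mkord; apply/colP=> x; rewrite summxE !mxE.
    by apply: eq_bigr => i _; rewrite !mxE /= rmorph1 expr1n mulr1 mulrC.
  case: w => a c; have [-> | nz_c _] := eqVneq c 0.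
    rewrite xpair_eqE eqxx andbT => nz_a.
    have -> : (a, 0) = (a * (1 : 'F_p, 0 : 'F_p).1, a * (1 : 'F_p, 0 : 'F_p).2).
      by rewrite /= mulr1 mulr0.
    rewrite evalV_scale /f orbit_cV_scale ?xpair_eqE ?oner_eq0 //.
    by rewrite -scalemxAr h10.
  have -> : (a, c) = (c * (a / c, 1 : 'F_p).1, c * (a / c, 1 : 'F_p).2).
    by rewrite /= mulr1 mulrC divfK.
  rewrite evalV_scale /f orbit_cV_scale ?xpair_eqE ?oner_eq0 ?andbF //.
  by rewrite -scalemxAr hc1.
exists h; last first.
  by rewrite -evalV10 hE ?xpair_eqE ?oner_eq0 //; apply/orbit_cV10/borel_weight_unip.
move=> u Gu; apply/eqP; rewrite -subr_eq0; apply/eqP.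
apply: (evalV_span kp) => c; have nz_c : (c, 1) != (0, 0) :> 'F_p * 'F_p.
  by rewrite xpair_eqE oner_eq0 andbF.
rewrite mulmxBl -!mulmxA hE // [X in _ - h *m X](evalV_act k Gu nz_c).
by rewrite hE ?plane_act_eq0 // /f orbit_cV_act ?subrr //; apply: borel_weight_unip.
Qed.

End BorelWeight.

(** * Unipotent invariant functionals on a projective cover *)

Lemma Vrepr_simple_repr m : (m < p)%N -> simple_repr (Vrepr charFp m.+1).
Proof. by move=> mp q W; apply: Vrepr_simple. Qed.

Lemma Vmx_unip_row0 m : delta_mx 0 ord0 *m Vmx F m.+1 (unip p) =
  delta_mx 0 ord0 :> 'rV_m.+1.
Proof.
apply/rowP=> k; rewrite -rowE mxE Vmx_unip mxE eqxx /=.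
by rewrite -val_eqE /=; case: (k : nat).
Qed.

(** The vectors fixed by the unipotent generator form a line, so an
    endomorphism acts on that line by a scalar. *)
Lemma Vrepr_endo m (q : 'M_m.+1) : (m < p)%N ->
  mxhom (Vrepr charFp m.+1) (Vrepr charFp m.+1) q -> exists c : F, q = c%:M.
Proof.
move=> mp homq; set e0 : 'rV[F]_m.+1 := delta_mx 0 ord0.
have homV u : u \in SL2 p -> Vmx F m.+1 u *m q = q *m Vmx F m.+1 u := homq u.
have nz_e0 : e0 != 0 by apply/eqP=> /rowP/(_ 0)/eqP; rewrite !mxE eqxx oner_eq0.
have [c e0q] : exists c : F, e0 *m q = c *: e0.
  have [e0q0 | nz_e0q] := eqVneq (e0 *m q) 0; first by exists 0; rewrite scale0r.
  have stable : (e0 *m q *m Vmx F m.+1 (unip p) <= e0 *m q)%MS.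
    by rewrite -mulmxA -homV ?unip_SL2 // mulmxA Vmx_unip_row0.
  have /sub_rVP[a ea] := unip_stable_delta0 mp stable nz_e0q.
  exists a^-1; rewrite -/e0 in ea; rewrite {2}ea scalerA mulVf ?scale1r //.
  by apply: contraNneq nz_e0 => a0; rewrite ea a0 scale0r.
exists c; apply/eqP; rewrite -subr_eq0; apply/eqP.
have homqc : mxhom (Vrepr charFp m.+1) (Vrepr charFp m.+1) (q - c%:M).
  by move=> u Gu; rewrite mulmxBr mulmxBl homq // scalar_mxC.
have : kermx (q - c%:M) != 0.
  apply: contraTneq (nz_e0) => K0; rewrite negbK -submx0 -K0.
  by apply/sub_kermxP; rewrite mulmxBr e0q mul_mx_scalar subrr.
move/(Vrepr_simple mp (mxhom_kermx homqc)).
by rewrite -sub1mx => /sub_kermxP; rewrite mul1mx.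
Qed.

Lemma borel_weight_lastcol m : borel_weight (Vrepr charFp m.+1) (delta_mx ord_max 0) m.
Proof.
move=> u; rewrite inE => /andP[Gu /eqP u10].
rewrite [LHS]Vmx_lastcol /first_col u10 -evalV10 -evalV_scale /=.
by rewrite mulr1 mulr0.
Qed.

Lemma borel_weight_hom n n' (rM : mx_representation F (SL2_group p) n)
    (rN : mx_representation F (SL2_group p) n') (h : 'M_(n, n')) th k :
  mxhom rM rN h -> borel_weight rN th k -> borel_weight rM (h *m th) k.
Proof.
move=> homh th_k u Bu; have /andP[Gu _] : (u \in SL2 p) && (GLval u 1 0 == 0).
  by move: Bu; rewrite inE.
by rewrite mulmxA homh // -mulmxA th_k // -scalemxAr.
Qed.

Lemma borel_weight_mod n (rM : mx_representation F (SL2_group p) n) th k :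
  borel_weight rM th (p.-1 + k) -> borel_weight rM th k.
Proof.
move=> th_k u Bu; rewrite th_k // exprD emb_expp1 ?mul1r //.
move: Bu; rewrite inE => /andP[/SL2_det D /eqP u10].
apply: contra_eq_neq D => ->.
by rewrite u10 mul0r mulr0 subrr eq_sym oner_neq0.
Qed.

Lemma trace_form_hom_mul n n' (rM : mx_representation F (SL2_group p) n)
    (rN : mx_representation F (SL2_group p) n') (h : 'M_(n, n')) th m :
  mxhom rM rN h -> trace_form rM (h *m th) m = h *m trace_form rN th m.
Proof.
move=> homh; rewrite mulmx_sumr; apply: eq_bigr => w /col_liftP[Gl _].
by rewrite /orbit_cV !mulmxA homh.
Qed.

Lemma trace_form_lin n (rM : mx_representation F (SL2_group p) n) (a : F) th (b : F) th' m :
  trace_form rM (a *: th + b *: th') m =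
    a *: trace_form rM th m + b *: trace_form rM th' m.
Proof.
rewrite !scaler_sumr -big_split; apply: eq_bigr => w _ /=.
by rewrite /orbit_cV mulmxDr -!scalemxAr mulmxDl -!scalemxAl.
Qed.

Lemma trace_form_lastcolE N m (i : 'I_N.+1) (j : 'I_m.+1) : (0 < N + m)%N ->
  trace_form (Vrepr charFp N.+1) (delta_mx ord_max 0) m i j =
    (-1) ^+ j * 'C(m, j)%:R * ((\sum_a emb a ^+ (i + (m - j)))
      * (\sum_c emb c ^+ (N - i + j))).
Proof.
move=> Nm0; rewrite -(sum_pairs (fun a => emb a ^+ _) (fun c => emb c ^+ _)).
rewrite mulr_sumr summxE [RHS](bigD1 (0, 0)) //= rmorph0 -exprD.
have -> : (i + (m - j) + (N - i + j) = N + m)%N.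
  by rewrite addnACA subnKC ?subnK ?leq_ord.
rewrite expr0n gtn_eqF // mulr0 add0r; apply: eq_bigr => w nz_w.
have [_ fl] := col_liftP nz_w.
rewrite /orbit_cV [X in X *m _](_ : _ = evalV N w); last first.
  by rewrite -{2}fl -Vmx_lastcol.
rewrite !mxE big_ord1 !mxE [(- emb _) ^+ _]exprNn !exprD -mulr_natr.
ring.
Qed.

Section Cover.

Variables (m n : nat) (P : mx_representation F (SL2_group p) n).
Variable f : 'M[F]_(n, m.+1).
Hypotheses (lt_mp : (m < p)%N) (projP : mxprojective P).
Hypotheses (homf : mxhom P (Vrepr charFp m.+1) f) (full_f : row_full f).
Hypothesis small_f :
  forall W : 'M_n, mxmodule P W -> row_full (W + kermx f)%MS -> row_full W.

Lemma cover_hom_other k (h : 'M_(n, k.+1)) : (k < p)%N -> k != m ->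
  mxhom P (Vrepr charFp k.+1) h -> h = 0.
Proof.
move=> lt_kp ne_km homh; apply: contraNeq ne_km => nz_h.
have [q [_ _ [->]]] := cover_hom_factor homf full_f small_f
  (Vrepr_simple_repr lt_mp) (Vrepr_simple_repr lt_kp) homh nz_h.
exact: eqxx.
Qed.

Lemma cover_hom_scalar (h : 'M_(n, m.+1)) :
  mxhom P (Vrepr charFp m.+1) h -> exists c : F, h = c *: f.
Proof.
move=> homh; have [-> | nz_h] := eqVneq h 0; first by exists 0; rewrite scale0r.
have simV := Vrepr_simple_repr lt_mp.
have [q [homq -> _]] := cover_hom_factor homf full_f small_f simV simV homh nz_h.
have [c ->] := Vrepr_endo lt_mp homq; exists c.
by rewrite mul_mx_scalar.
Qed.

(** This functional gives the top factor of the restriction of P that does not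
    come from V_(m+1). The trace of the functional extracting the coefficient of
    x^N maps the forms of degree N = 2(p - 1) - m onto those of degree m;
    projectivity of P lifts f along this map, and th is the coefficient of x^N
    after the lift. The degree N exceeds the weight p - 1 - m by p - 1 because
    on forms of degree p - 1 - m the trace is zero. *)
Lemma trace_form_lift : (m < p.-1)%N ->
  exists2 th, borel_weight P th (p.-1 - m) & trace_form P th m = f.
Proof.
move=> lt_mp1; pose N := (p.-1 + (p.-1 - m))%N.
have mp1 := ltnW lt_mp1.
have N_unip := borel_weight_unip (@borel_weight_lastcol N).
pose D := trace_form (Vrepr charFp N.+1) (delta_mx ord_max 0) m.
have homD : mxhom (Vrepr charFp N.+1) (Vrepr charFp m.+1) D by exact: trace_form_hom.
have iN : (p.-1 < N.+1)%N by rewrite ltnS leq_addr.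
have p1 : (0 < p.-1)%N by apply: leq_ltn_trans lt_mp1.
have sum1 : \sum_c emb c ^+ p.-1 = -1.
  by rewrite sum_emb_exp ?eqxx // -addnn -[X in (X < _)%N]addn0 ltn_add2l.
(* The form x^(p-1) y^(p-1-m) is mapped to a nonzero multiple of x^m: the two
   power sums involved have exponent p - 1. *)
have nz_D : D != 0.
  apply/eqP=> /matrixP/(_ (Ordinal iN) ord_max)/eqP.
  rewrite trace_form_lastcolE /=; last by rewrite addn_gt0 addn_gt0 p1.
  rewrite subnn addn0 addKn subnK // sum1 binn mulr1 mxE mulrNN !mulr1.
  by rewrite signr_eq0.
have full_D := Vrepr_simple_repr lt_mp (mxhom_image homD (mxmodule1 _)).
rewrite mul1mx in full_D.
have [h homh hD] := projP homD (full_D nz_D) homf.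
exists (h *m delta_mx ord_max 0).
  apply: borel_weight_mod; apply: borel_weight_hom homh _.
  exact: borel_weight_lastcol.
by rewrite (trace_form_hom_mul _ _ homh).
Qed.

Let th0 : 'cV[F]_n := f *m delta_mx ord_max 0.

Lemma th0_weight : borel_weight P th0 m.
Proof. apply: borel_weight_hom homf _; exact: borel_weight_lastcol. Qed.

(** The power sums involved have exponents adding up to 2m, so that one of them
    has exponent less than p - 1. *)
Lemma th0_trace : (0 < m < p.-1)%N -> trace_form P th0 m = 0.
Proof.
case/andP=> m0 mp1; rewrite (trace_form_hom_mul _ _ homf).
rewrite [X in _ *m X](_ : _ = 0) ?mulmx0 //; apply/matrixP=> i j.
rewrite trace_form_lastcolE ?addn_gt0 ?m0 // mxE.
set a := (i + (m - j))%N; set b := (m - i + j)%N.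
have ab : (a + b = m.*2)%N.
  by rewrite addnACA subnKC ?subnK ?leq_ord // addnn.
have lt2 : (m.*2 < p.-1.*2)%N by rewrite ltn_double.
have a2 : (a < p.-1.*2)%N by apply: leq_ltn_trans lt2; rewrite -ab leq_addr.
have b2 : (b < p.-1.*2)%N by apply: leq_ltn_trans lt2; rewrite -ab leq_addl.
rewrite !sum_emb_exp //.
have [ea | _] := eqVneq a p.-1; last by rewrite mulr0n mul0r mulr0.
have [eb | _] := eqVneq b p.-1; last by rewrite mulr0n mulr0 mulr0.
by rewrite -ab ea eb addnn ltnn in lt2.
Qed.

Lemma th0_neq0 : th0 != 0.
Proof.
have [g gf] := row_fullP full_f; apply/eqP=> /(congr1 (mulmx g)).
rewrite mulmx0 mulmxA gf mul1mx => /matrixP/(_ ord_max 0)/eqP.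
by rewrite !mxE !eqxx oner_eq0.
Qed.

(* For m = p - 1 the hypothesis on th1 is void; its multiples below are then
   cancelled by the factor m < p - 1. *)
Variable th1 : 'cV[F]_n.
Hypothesis th1P :
  (m < p.-1)%N -> borel_weight P th1 (p.-1 - m) /\ trace_form P th1 m = f.

Let spanned th := exists c0 c1 : F,
  th = (c0 *+ (0 < m)%N) *: th0 + (c1 *+ (m < p.-1)%N) *: th1.

(** A functional without trace comes from a homomorphism to the forms of degree
    k, and those are known. *)
Lemma borel_weight_traceless_spanned th k : (0 < k < p)%N ->
  borel_weight P th k -> trace_form P th (p.-1 - k) = 0 -> spanned th.
Proof.
case/andP=> k0 kp th_k tr0.
have km : (k + (p.-1 - k) = p.-1)%N by rewrite subnKC // -ltnS prednK ?prime_gt0.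
have [ekm | ne_km] := eqVneq k m; last first.
  have [h homh <-] := trace_form_eq0 th_k k0 km tr0.
  rewrite (cover_hom_other kp ne_km homh) mul0mx; exists 0, 0.
  by rewrite !mul0rn !scale0r addr0.
subst k; have [h homh <-] := trace_form_eq0 th_k k0 km tr0.
have [c ->] := cover_hom_scalar homh; exists c, 0.
by rewrite k0 mul0rn scale0r addr0 mulr1n scalemxAl.
Qed.

(** The trace is a homomorphism to V_(p-k), hence vanishes unless p - k = m + 1;
    in that case subtracting a multiple of th1 kills it. *)
Lemma borel_weight_spanned th k : (0 < k < p)%N -> borel_weight P th k -> spanned th.
Proof.
move=> k_bnd th_k; have [k0 kp] := andP k_bnd.
have le_kp1 : (k <= p.-1)%N by rewrite -ltnS prednK ?prime_gt0.
have s_lt_p : (p.-1 - k < p)%N.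
  by rewrite (leq_ltn_trans (leq_subr _ _)) // ltn_predL prime_gt0.
have homT := trace_form_hom (borel_weight_unip th_k) (p.-1 - k).
have [sm | ne_sm] := eqVneq (p.-1 - k)%N m; last first.
  apply: (borel_weight_traceless_spanned k_bnd th_k).
  exact: cover_hom_other homT.
have lt_mp1 : (m < p.-1)%N by rewrite -sm ltn_subrL k0 (leq_trans k0).
have [th1_k tr1] := th1P lt_mp1.
have [c trc] : exists c : F, trace_form P th m = c *: f.
  by apply: cover_hom_scalar; rewrite -sm.
have [||c0 [c1 eth]] := @borel_weight_traceless_spanned (1 *: th + (- c) *: th1) k k_bnd.
- move=> u Bu; rewrite mulmxDr -!scalemxAr th_k // th1_k // -sm subKn //.
  by rewrite scalerDr !scalerA mulr1 mul1r [- c * _]mulrC.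
- by rewrite sm trace_form_lin trc tr1 scale1r scaleNr subrr.
exists c0, (c1 + c).
rewrite lt_mp1 mulr1n scalerDl addrA; move: eth; rewrite lt_mp1 mulr1n => <-.
by rewrite scale1r scaleNr subrK.
Qed.

(** A functional fixed by the unipotents is the sum of its isotypic components
    under the torus. The part of weight k is obtained by averaging over the
    torus, the order p - 1 = -1 of which is invertible. *)
Lemma unip_fixed_spanned th : P (unip p) *m th = th -> spanned th.
Proof.
move=> th_g.
pose part k := - \sum_(z : 'F_p | z != 0) (emb z)^-1 ^+ k *: orbit_cV P th (z, 0).
have part_k k : borel_weight P (part k) k.
  move=> u Bu; have /andP[Gu /eqP u10] : (u \in SL2 p) && (GLval u 1 0 == 0).
    by move: Bu; rewrite inE.
  have nz_u : GLval u 0 0 != 0.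
    by have := first_col_neq0 Gu; rewrite /first_col u10 xpair_eqE eqxx andbT.
  rewrite mulmxN scalerN mulmx_sumr scaler_sumr; congr (- _).
  rewrite [RHS](reindex_inj (mulfI nz_u)) /=; apply: eq_big => [z | z nz_z].
    by rewrite mulf_eq0 (negPf nz_u).
  have nz_z0 : (z, 0) != (0, 0) :> 'F_p * 'F_p by rewrite xpair_eqE eqxx andbT.
  rewrite -scalemxAr orbit_cV_act // /plane_act u10 /= !mulr0 !addr0 mul0r scalerA.
  rewrite rmorphM invfM exprMn mulrA -exprMn divff ?expr1n ?mul1r //.
  by rewrite fmorph_eq0.
have sum_part : th = \sum_(k < p.-1) part k.+1.
  rewrite sumrN exchange_big (bigD1 1) ?oner_neq0 //=.
  rewrite [X in _ = - (_ + X)]big1 => [|z /andP[nz_z ne_z1]].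
    rewrite orbit_cV10 // rmorph1 invr1; under eq_bigr do rewrite expr1n scale1r.
    rewrite sumr_const card_ord addr0 -scaler_nat -subn1 natrB ?prime_gt0 //.
    by rewrite pcharf0 // sub0r scaleN1r opprK.
  rewrite -scaler_suml [X in X *: _](_ : _ = 0) ?scale0r //.
  set x := (emb z)^-1; have x1 : x - 1 != 0.
    rewrite subr_eq0 invr_eq1; apply: contraNneq ne_z1 => ez1.
    have : emb z == emb 1 by rewrite ez1 rmorph1.
    by rewrite (inj_eq (fmorph_inj _)).
  apply: (mulfI x1); rewrite mulr0; under eq_bigr do rewrite exprS.
  rewrite -mulr_sumr mulrCA -subrX1 exprVn emb_expp1 //.
  by rewrite invr1 subrr mulr0.
rewrite sum_part; elim/big_ind: _ => [|x y [x0 [x1 ->]] [y0 [y1 ->]]|k _].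
- by exists 0, 0; rewrite !mul0rn !scale0r addr0.
- by exists (x0 + y0), (x1 + y1); rewrite !mulrnDl !scalerDl addrACA.
apply: borel_weight_spanned (part_k _).
by rewrite /= -[X in (_ < X)%N]prednK ?prime_gt0 // ltnS.
Qed.

(** The trace separates th1 from th0. *)
Lemma th0_th1_free (c0 c1 : F) : (0 < m < p.-1)%N ->
  c0 *: th0 + c1 *: th1 = 0 -> c0 = 0 /\ c1 = 0.
Proof.
move=> m_bnd c01; have [m0 mp1] := andP m_bnd.
have nz_f : f != 0.
  by apply: contraNneq th0_neq0 => f0; rewrite /th0 f0 mul0mx.
have c1_0 : c1 = 0.
  have := trace_form_lin P c0 th0 c1 th1 m; rewrite c01 th0_trace // scaler0 add0r.
  have [_ ->] := th1P mp1; rewrite /trace_form big1 => [/esym/eqP|w _].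
    by rewrite scaler_eq0 (negPf nz_f) orbF => /eqP.
  by rewrite /orbit_cV mulmx0 mul0mx.
split=> //; move/eqP: c01; rewrite c1_0 scale0r addr0 scaler_eq0.
by rewrite (negPf th0_neq0) orbF => /eqP.
Qed.

Lemma th1_neq0 : (m < p.-1)%N -> th1 != 0.
Proof.
move=> mp1; have [_ tr1] := th1P mp1; apply: contraNneq th0_neq0 => th1_0.
rewrite /th0 -tr1 th1_0 /trace_form big1 ?mul0mx // => w _.
by rewrite /orbit_cV mulmx0 mul0mx.
Qed.

End Cover.

(** * The uniserial modules of the Borel subgroup *)

Lemma borel_sub_SL2 u : u \in borel p -> u \in SL2 p /\ GLval u 1 0 = 0.
Proof. by rewrite inE => /andP[Gu /eqP]. Qed.

Definition borel_char k u : F := emb (GLval u 0 0) ^+ k.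

Lemma borel_charM k u v : v \in borel p ->
  borel_char k (u * v)%g = borel_char k u * borel_char k v.
Proof.
move=> /borel_sub_SL2[_ v10].
by rewrite /borel_char GL_M2E v10 mulr0 addr0 rmorphM exprMn.
Qed.

Lemma borel_char1 k : borel_char k (1%g : {'GL_2(p)}) = 1.
Proof. by rewrite /borel_char GL_1E mxE rmorph1 expr1n. Qed.

Lemma borel_char_repr k : mx_repr (borel_group p) (fun u => (borel_char k u)%:M : 'M_1).
Proof.
split=> [|u v _ Bv]; first by rewrite borel_char1.
by rewrite borel_charM // scalar_mxM.
Qed.

Definition borelS k := MxRepresentation (borel_char_repr k).

(** The restriction of the Steinberg module V_p to the Borel subgroup is
    uniserial with trivial socle and top, and twisting it by a character shifts
    the weights of all its composition factors. The dimension is written as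
    p.-1.+1 for the sake of the index of the highest monomial. *)
Lemma borelU_mx_repr k :
  mx_repr (borel_group p) (fun u => borel_char k u *: Vmx F p.-1.+1 u).
Proof.
split=> [|u v Bu Bv].
  by rewrite borel_char1 scale1r -[Vmx _ _ _]/(Vrepr charFp p.-1.+1 _) repr_SL2_1.
have [[Gu _] [Gv _]] := (borel_sub_SL2 Bu, borel_sub_SL2 Bv).
rewrite borel_charM // -scalemxAl -scalemxAr scalerA; congr (_ *: _).
exact: (repr_SL2M (Vrepr charFp p.-1.+1)).
Qed.

Definition borelU k := MxRepresentation (borelU_mx_repr k).

Lemma lt_p1p : (p.-1 < p)%N.
Proof. by rewrite ltn_predL prime_gt0. Qed.

Lemma borelU_unip k : borelU k (unip p) = Vmx F p.-1.+1 (unip p).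
Proof. by rewrite /= /borel_char mxE rmorph1 expr1n scale1r. Qed.

Definition flag r : 'M[F]_p.-1.+1 := pid_mx r.

Lemma flagP r q (W : 'M_(q, p.-1.+1)) :
  reflect (forall i (j : 'I_p.-1.+1), (r <= j)%N -> W i j = 0) (W <= flag r)%MS.
Proof.
apply: (iffP idP) => [/submxP[Y ->] i j le_rj | W0].
  rewrite mxE big1 // => l _; rewrite mxE.
  case: eqP => [elj | _] /=; last by rewrite mulr0.
  by rewrite elj ltnNge le_rj mulr0.
apply/submxP; exists W; apply/matrixP=> i j; rewrite mxE (bigD1 j) //=.
rewrite mxE eqxx big1 ?addr0 => [|l ne_lj]; last first.
  by rewrite mxE val_eqE (negPf ne_lj) mulr0.
by case: ltnP => [_ | /W0->]; rewrite ?mulr1 ?mul0r.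
Qed.

Lemma flag_leq r s : (r <= s)%N -> (flag r <= flag s)%MS.
Proof.
move=> le_rs; apply/flagP=> i j le_sj; rewrite mxE.
case: eqP => [eij | _] //=; rewrite eij ltnNge.
by rewrite (leq_trans le_rs le_sj).
Qed.

Lemma rank_flag r : (r <= p.-1.+1)%N -> \rank (flag r) = r.
Proof. by move=> le_r; rewrite rank_pid_mx. Qed.

(** A submodule contains all the lower monomials of any of its vectors, so it is
    determined by the largest exponent of x that occurs in it. *)
Lemma borelU_submodule k (W : 'M_p.-1.+1) : mxmodule (borelU k) W ->
  exists2 r, (r <= p.-1.+1)%N & (W :=: flag r)%MS.
Proof.
move=> /mxmoduleP modW; have Wg : (W *m Vmx F p.-1.+1 (unip p) <= W)%MS.
  by rewrite -(borelU_unip k) modW ?unip_borel.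
have [W0 | nzW] := eqVneq W 0.
  by exists 0%N => //; rewrite W0 /flag pid_mx_0.
pose Q (j : 'I_p.-1.+1) := [exists i, W i j != 0].
have [j0 Qj0] : exists j, Q j.
  apply/existsP; apply: contraR nzW; rewrite negb_exists => /forallP Q0.
  apply/eqP/matrixP=> i j; rewrite mxE; apply/eqP; rewrite -[_ == _]negbK.
  by apply: contra (Q0 j) => Wij; apply/existsP; exists i.
have [r Qr max_r] := arg_maxnP (fun j : 'I_p.-1.+1 => j : nat) Qj0.
have [i Wir] := existsP Qr.
have Wi0 i' (j : 'I_p.-1.+1) : (r < j)%N -> W i' j = 0.
  move=> rj; apply/eqP; apply: contraTT rj => nz_Wj; rewrite -leqNgt.
  by apply: max_r; apply/existsP; exists i'.
exists r.+1 => //; apply/eqmxP/andP; split; first by apply/flagP.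
apply/row_subP=> j.
have [lt_jr | le_rj] := ltnP j r.+1.
  have -> : row j (flag r.+1) = delta_mx 0 j.
    apply/rowP=> l; rewrite !mxE eqxx lt_jr andbT /= [in RHS]eq_sym.
    by rewrite val_eqE.
  apply: (unip_stable_flag lt_p1p Wg (row_sub i W) (r := r)) => //.
    by rewrite mxE.
  by move=> l rl; rewrite mxE Wi0.
have -> : row j (flag r.+1) = 0; last exact: sub0mx.
by apply/rowP=> l; rewrite !mxE ltnNge le_rj andbF.
Qed.

Lemma borelU_uniserial k : mxuniserial (borelU k).
Proof.
move=> U W /borelU_submodule[r _ eU] /borelU_submodule[s _ eW].
rewrite !eU !eW.
by case/orP: (leq_total r s) => /flag_leq ->; rewrite ?orbT.
Qed.

Lemma Vmx_borel_trig m u (i j : 'I_m.+1) : u \in borel p -> (i < j)%N ->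
  Vmx F m.+1 u i j = 0.
Proof.
move=> /borel_sub_SL2[_ u10] lt_ij.
rewrite VmxE u10 rmorph0 scale0r add0r -polyC_exp mulrC mul_polyC coefZ.
by rewrite coef_lin_exp bin_small // mulr0n mulr0.
Qed.

Lemma flag_mulE r (A : 'M[F]_p.-1.+1) (i j : 'I_p.-1.+1) :
  (flag r *m A) i j = A i j *+ (i < r)%N.
Proof.
rewrite mxE (bigD1 i) //= mxE eqxx big1 ?addr0 => [|l ne_li].
  by case: (i < r)%N; rewrite ?mul1r ?mul0r.
by rewrite mxE eq_sym val_eqE (negPf ne_li) mul0r.
Qed.

Lemma flag_module k r : mxmodule (borelU k) (flag r).
Proof.
apply/mxmoduleP=> u Bu; rewrite /= -scalemxAr; apply/scalemx_sub/flagP=> i j le_rj.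
rewrite flag_mulE; case: ltnP => // lt_ir.
by rewrite Vmx_borel_trig // (leq_trans lt_ir).
Qed.

Definition flag_seq := mkseq (fun i => flag i.+1) p.-1.+1.

Lemma nth_flag_seq i : (i < p.-1.+1)%N -> flag_seq`_i = flag i.+1.
Proof. by move=> ip; rewrite nth_mkseq. Qed.

Lemma nth_cons_flag_seq i : (i < p.-1.+1)%N -> (0 :: flag_seq)`_i = flag i.
Proof.
case: i => [_ | i ip]; first by rewrite /flag pid_mx_0.
by rewrite /= nth_flag_seq // ltnW.
Qed.

Lemma flag_seq_series k : mx_composition_series (borelU k) flag_seq.
Proof.
split=> [|i]; first by apply/allP=> _ /mapP[i _ ->]; apply: flag_module.
rewrite size_mkseq => ip; rewrite nth_flag_seq // nth_cons_flag_seq //.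
split=> [|W [/borelU_submodule[r le_r eW]]].
  by rewrite ltmxErank flag_leq // !rank_flag ?ltnSn // ltnW.
move=> /rank_ltmx; rewrite eW !rank_flag // => [lt_ir|]; last exact: ltnW.
by move=> /rank_ltmx; rewrite eW !rank_flag // ltnS leqNgt lt_ir.
Qed.

(** The factor spanned by x^i y^(p-1-i) has weight k + i - (p - 1 - i), which is
    k + 2i modulo p - 1. *)
Lemma borelU_is_U (zeta : {unit 'F_p}) (a : int) k :
  emb (val zeta) ^ a = emb (val zeta) ^+ k -> is_U zeta a (borelU k).
Proof.
move=> zak; split; first exact: borelU_uniserial.
exists flag_seq, (flag_seq_series k); split.
  rewrite (last_nth 0) size_mkseq /= nth_flag_seq // /flag pid_mx_1.
  exact: eqmx_refl.
rewrite size_mkseq => i ip.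
have le_ip : (i <= p.-1)%N by [].
have nz_z : val zeta != 0 by apply: contraTneq (valP zeta) => /= ->; rewrite unitr0.
split.
- rewrite genmxE; apply: (@addIn (\rank (0 :: flag_seq)`_i)).
  rewrite mxrank_in_factmod (addsmx_idPr _); last first.
    by rewrite nth_flag_seq // nth_cons_flag_seq // flag_leq.
  by rewrite nth_flag_seq // nth_cons_flag_seq // !rank_flag ?(ltnW ip).
- rewrite /series_repr /subseries_repr; apply: section_repr_scalar (unip_borel p) _.
  rewrite nth_flag_seq // nth_cons_flag_seq // borelU_unip scale1r; apply/flagP=> l j le_ij.
  rewrite [LHS]mxE flag_mulE Vmx_unip !mxE.
  case: ltnP => [lt_li | _]; last by rewrite andbF subr0.
  rewrite andbT; have [-> | ne_lj] := eqVneq; first by rewrite binn subrr.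
  rewrite bin_small ?subrr // ltn_neqAle ne_lj.
  exact: leq_trans le_ij.
rewrite /series_repr /subseries_repr; apply: section_repr_scalar (torus_borel zeta) _.
rewrite nth_flag_seq // nth_cons_flag_seq //=; apply/flagP=> l j le_ij.
rewrite [LHS]mxE -scalemxAr [X in X + _]mxE flag_mulE Vmx_torus !mxE.
case: ltnP => [lt_li | _]; last by rewrite andbF !mulr0 subr0.
rewrite andbT; have [elj | ne_lj] := eqVneq l j; last first.
  by rewrite /= mulr0n mul0rn val_eqE (negPf ne_lj) !mulr0 subr0.
have eli : j = i :> nat by apply/eqP; rewrite eqn_leq le_ij -elj -ltnS lt_li.
have nz_ez : emb (val zeta) != 0 by rewrite fmorph_eq0.
rewrite elj eqxx eli !mulr1n mulr1 /borel_char mxE /=.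
have -> : 2 * i%:Z = (i.*2)%:Z by rewrite -mul2n PoszM.
rewrite expfzDr // zak.
have -> : emb (val zeta)^-1 ^+ (p.-1 - i) = emb (val zeta) ^+ i.
  apply: (mulfI (expf_neq0 (p.-1 - i) nz_ez)).
  rewrite fmorphV -exprMn divff // expr1n -exprD subnK // emb_expp1 //.
by rewrite -exprD addnn -exprnP subrr.
Qed.

(** In the equation for the coordinate number k + 1, the coordinate number k has
    coefficient k + 1, which is nonzero. *)
Lemma Vmx_unip_fixed m (y : 'cV[F]_m.+1) : (m < p)%N ->
  Vmx F m.+1 (unip p) *m y = y -> exists c : F, y = c *: delta_mx ord_max 0.
Proof.
move=> lt_mp fix_y.
have y0 k (km : (k < m)%N) : y (inord k) 0 = 0.
  elim/ltn_ind: k km => k IHk km.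
  have km1 : (k.+1 < m.+1)%N by [].
  have /colP/(_ (Ordinal km1)) := fix_y; rewrite mxE.
  rewrite (bigD1 (Ordinal km1)) //= Vmx_unip binn mul1r => /(canRL (addKr _)).
  rewrite addNr (bigD1 (inord k)) /=; last first.
    by rewrite -val_eqE /= inordK ?ltn_eqF // ltnW.
  rewrite Vmx_unip inordK ?(ltnW km1) // binSn big1 ?addr0 => [/eqP|l /andP[ne1 ne2]].
    by rewrite mulf_eq0 (negPf (pchar_natr_neq0 _)) ?(leq_ltn_trans km) // => /eqP.
  have [lk | lk | lk] := ltngtP l k.
  - by rewrite -[l]inord_val IHk ?mulr0 // (ltn_trans lk).
  - rewrite Vmx_unip bin_small ?mul0r //= ltn_neqAle lk andbT.
    by rewrite eq_sym; move: ne1; rewrite -val_eqE.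
  by case/eqP: ne2; rewrite -lk inord_val.
exists (y ord_max 0); apply/colP=> i; rewrite !mxE andbT.
have [-> | ne_i] := eqVneq i ord_max; first by rewrite mulr1.
rewrite mulr0 -[i]inord_val y0 // ltn_neqAle -[(_ <= _)%N]ltnS ltn_ord andbT.
by move: ne_i; rewrite -val_eqE.
Qed.

Lemma borelU_lastcol k u : u \in borel p ->
  borelU k u *m delta_mx ord_max 0 =
    borel_char k u *: delta_mx ord_max 0 :> 'cV_p.-1.+1.
Proof.
move=> Bu; rewrite /= -scalemxAl; congr (_ *: _).
have [Gu u10] := borel_sub_SL2 Bu.
rewrite -[Vmx _ _ u]/(Vrepr charFp p.-1.+1 u) borel_weight_lastcol //.
rewrite emb_expp1 ?scale1r //.
by have := first_col_neq0 Gu; rewrite /first_col u10 xpair_eqE eqxx andbT.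
Qed.

(** A functional of weight k is a homomorphism to the top of the uniserial
    module, along which it lifts since restriction preserves projectivity. *)
Lemma borel_lift n (P : mx_representation F (SL2_group p) n) th k :
  mxprojective P -> borel_weight P th k ->
  exists2 l : 'M_(n, p.-1.+1), mxhom (subg_repr P (borel_sub p)) (borelU k) l &
    l *m delta_mx ord_max 0 = th.
Proof.
move=> projP th_k.
have hom_top : mxhom (borelU k) (borelS k) (delta_mx ord_max 0 : 'cV_p.-1.+1).
  by move=> u Bu; rewrite borelU_lastcol //= mul_mx_scalar.
have full_top : row_full (delta_mx ord_max 0 : 'cV[F]_p.-1.+1).
  apply/row_fullP; exists (delta_mx 0 ord_max).
  by rewrite mul_delta_mx; apply/matrixP=> i j; rewrite !ord1 !mxE !eqxx.
have hom_th : mxhom (subg_repr P (borel_sub p)) (borelS k) th.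
  by move=> u Bu; rewrite /= th_k // mul_mx_scalar.
exact: (mxprojective_subg (sHG := borel_sub p) projP hom_top full_top hom_th).
Qed.

(** * Restriction of a projective cover *)

Lemma unip_expp : (unip p ^+ p)%g = 1%g.
Proof.
have p0 : p%:R = 0 :> 'F_p by rewrite pcharf0 // pchar_Fp.
by apply: GL2P; rewrite unip_expE GL_1E !mxE //= p0.
Qed.

Section RestrictionToBorel.

Variables (n : nat) (P : mx_representation F (SL2_group p) n).
Hypothesis projP : mxprojective P.
Local Notation ResP := (subg_repr P (borel_sub p)).

Lemma rsim_borelU k (th : 'cV[F]_n) : borel_weight P th k -> th != 0 ->
    (forall x, P (unip p) *m x = x -> exists c : F, x = c *: th) ->
  mx_rsim ResP (borelU k).
Proof.
move=> th_k nz_th span_th; have [l homl lE] := borel_lift projP th_k.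
apply: (lift_top_rsim charFp (unip_borel p) unip_expp _ _ _ _ homl lE).
- by move=> x /span_th[c ->]; exists c%:M; rewrite mul_mx_scalar.
- move=> y; rewrite [y]mx11_scalar mul_mx_scalar => /eqP.
  by rewrite scaler_eq0 (negPf nz_th) orbF => /eqP->; rewrite raddf0.
- move=> y; rewrite borelU_unip => /(Vmx_unip_fixed lt_p1p)[c ->].
  by exists c%:M; rewrite mul_mx_scalar.
by rewrite muln1 prednK ?prime_gt0.
Qed.

Lemma rsim_borelU2 k0 k1 (th0 th1 : 'cV[F]_n) :
    borel_weight P th0 k0 -> borel_weight P th1 k1 ->
    (forall c0 c1 : F, c0 *: th0 + c1 *: th1 = 0 -> c0 = 0 /\ c1 = 0) ->
    (forall x, P (unip p) *m x = x -> exists c0 c1 : F, x = c0 *: th0 + c1 *: th1) ->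
  mx_rsim ResP (mxdsum (borelU k0) (borelU k1)).
Proof.
move=> th0_k th1_k free_th span_th.
have [l0 homl0 l0E] := borel_lift projP th0_k.
have [l1 homl1 l1E] := borel_lift projP th1_k.
pose e : 'cV[F]_p.-1.+1 := delta_mx ord_max 0.
have homl : mxhom ResP (mxdsum (borelU k0) (borelU k1)) (row_mx l0 l1).
  move=> u Bu; rewrite mul_mx_row homl0 // homl1 //=.
  by rewrite mul_row_block !mulmx0 addr0 add0r.
have lE : row_mx l0 l1 *m block_mx e 0 0 e = row_mx th0 th1.
  by rewrite mul_row_block !mulmx0 addr0 add0r l0E l1E.
have mul_th (y : 'cV[F]_(1 + 1)) :
    row_mx th0 th1 *m y = usubmx y 0 0 *: th0 + dsubmx y 0 0 *: th1.
  rewrite -{1}[y]vsubmxK mul_row_col [usubmx y]mx11_scalar [dsubmx y]mx11_scalar.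
  by rewrite !mul_mx_scalar !mxE.
apply: (lift_top_rsim charFp (unip_borel p) unip_expp _ _ _ _ homl lE).
- move=> x /span_th[c0 [c1 ->]]; exists (col_mx c0%:M c1%:M).
  by rewrite mul_row_col !mul_mx_scalar.
- move=> y; rewrite mul_th => /free_th[y0 y1].
  rewrite -[y]vsubmxK [usubmx y]mx11_scalar [dsubmx y]mx11_scalar y0 y1.
  by rewrite !raddf0 col_mx0.
- move=> y; rewrite -[y]vsubmxK [mxdsum _ _ _]/(block_mx (borelU k0 _) 0 0 (borelU k1 _)).
  rewrite mul_block_col !mul0mx addr0 add0r !borelU_unip.
  case/eq_col_mx=> /(Vmx_unip_fixed lt_p1p)[c0 ->] /(Vmx_unip_fixed lt_p1p)[c1 ->].
  exists (col_mx c0%:M c1%:M).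
  by rewrite mul_block_col !mul0mx addr0 add0r !mul_mx_scalar.
by rewrite mulnDr muln1 -[LHS]/(p.-1.+1 + p.-1.+1)%N prednK ?prime_gt0.
Qed.

End RestrictionToBorel.

Lemma cover_res_single m n (P : mx_representation F (SL2_group p) n) :
    (m < p)%N -> (m == 0%N) || (m == p.-1) ->
    projective_cover P (Vrepr charFp m.+1) ->
  mx_rsim (subg_repr P (borel_sub p)) (borelU p.-1).
Proof.
move=> lt_mp m_end [projP [f [homf full_f small_f]]].
have p1_gt0 : (0 < p.-1)%N by rewrite -ltnS prednK ?prime_gt0 ?prime_gt1.
have [lt_mp1 | le_p1m] := ltnP m p.-1.
  have m0 : m = 0%N by case/orP: m_end => /eqP // mp1; rewrite mp1 ltnn in lt_mp1.
  subst m.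
  have [th1 th1_k tr1] := trace_form_lift lt_mp projP homf lt_mp1.
  have th1P : (0 < p.-1)%N -> borel_weight P th1 (p.-1 - 0) /\ trace_form P th1 0 = f by [].
  apply: (rsim_borelU projP (th := th1)); first by rewrite -[X in borel_weight _ _ X]subn0.
    exact: (th1_neq0 full_f th1P).
  move=> x /(unip_fixed_spanned lt_mp homf full_f small_f th1P)[c0 [c1 ->]].
  by exists c1; rewrite lt_mp1 mulr0n scale0r add0r mulr1n.
have mp1 : m = p.-1.
  by case/orP: m_end => /eqP // m0; rewrite m0 leqNgt p1_gt0 in le_p1m.
have th1P : (m < p.-1)%N -> borel_weight P 0 (p.-1 - m) /\ trace_form P 0 m = f.
  by rewrite ltnNge le_p1m.
apply: (rsim_borelU projP (th := f *m delta_mx ord_max 0)).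
- by rewrite -mp1; apply: th0_weight.
- exact: th0_neq0.
move=> x /(unip_fixed_spanned lt_mp homf full_f small_f th1P)[c0 [c1 ->]].
have m_gt0 : (0 < m)%N by rewrite mp1.
by exists c0; rewrite m_gt0 mulr1n scaler0 addr0.
Qed.

Lemma cover_res_double m n (P : mx_representation F (SL2_group p) n) :
    (0 < m < p.-1)%N -> projective_cover P (Vrepr charFp m.+1) ->
  mx_rsim (subg_repr P (borel_sub p)) (mxdsum (borelU m) (borelU (p.-1 - m))).
Proof.
move=> m_bnd [projP [f [homf full_f small_f]]]; have [m0 lt_mp1] := andP m_bnd.
have lt_mp : (m < p)%N := ltn_trans lt_mp1 lt_p1p.
have [th1 th1_k tr1] := trace_form_lift lt_mp projP homf lt_mp1.
have th1P : (m < p.-1)%N -> borel_weight P th1 (p.-1 - m) /\ trace_form P th1 m = f by [].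
apply: (rsim_borelU2 projP (th0_weight homf) th1_k).
  by move=> c0 c1; apply: (th0_th1_free homf full_f th1P m_bnd).
move=> x /(unip_fixed_spanned lt_mp homf full_f small_f th1P)[c0 [c1 ->]].
by exists c0, c1; rewrite m0 lt_mp1 !mulr1n.
Qed.

End Forms.

Theorem lemma5p7 (F : closedFieldType) (p : nat) (charFp : p \in [pchar F])
    (odd_p : odd p) (zeta : {unit 'F_p})
    (zeta_gen : generator [set: {unit 'F_p}] zeta)
    (t : nat) (t_bounds : (1 <= t <= p)%N)
    (n : nat) (P : mx_representation F (SL2_group p) n)
    (P_cover : projective_cover P (Vrepr charFp t)) :
  let ResP := subg_repr P (borel_sub p) in
  if (t == 1%N) || (t == p) then
    exists2 U : mx_representation F (borel_group p) p,
      is_U zeta 0 U & mx_rsim ResP U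
  else
    exists (U1 U2 : mx_representation F (borel_group p) p),
      [/\ is_U zeta (t%:Z - 1) U1, is_U zeta (p%:Z - t%:Z) U2 &
          mx_rsim ResP (mxdsum U1 U2)].
Proof.
move=> ResP; have p_pr := pcharf_prime charFp.
have p_gt0 := prime_gt0 p_pr.
case: t t_bounds P_cover => [//|m] lt_mp P_cover.
suff restrict q (def_q : q = p.-1.+1) :
  if (m.+1 == 1%N) || (m.+1 == p) then
    exists2 U : mx_representation F (borel_group p) q,
      is_U zeta 0 U & mx_rsim ResP U
  else
    exists (U1 U2 : mx_representation F (borel_group p) q),
      [/\ is_U zeta (m.+1%:Z - 1) U1, is_U zeta (p%:Z - m.+1%:Z) U2 &
          mx_rsim ResP (mxdsum U1 U2)] by exact: restrict (esym (prednK p_gt0)).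
subst q; rewrite eqSS -[X in _ || (_ == X)](prednK p_gt0) eqSS.
have le_mp1 : (m <= p.-1)%N by rewrite -ltnS prednK.
case: ifPn => [m_end | /norP[m_neq0 m_neqp1]].
  exists (borelU charFp p.-1); last exact: cover_res_single m_end P_cover.
  apply: borelU_is_U; rewrite expr0z (emb_expp1 charFp) //.
  by apply: contraTneq (valP zeta) => /= ->; rewrite unitr0.
exists (borelU charFp m), (borelU charFp (p.-1 - m)); split.
- by apply: borelU_is_U; rewrite intS addrAC subrr add0r.
- apply: borelU_is_U; rewrite -[X in X%:Z - _](prednK p_gt0).
  by rewrite subzn ?subSS // exprnP.
apply: cover_res_double P_cover; rewrite lt0n m_neq0 ltn_neqAle m_neqp1.
exact: le_mp1.
Qed.
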